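(* Let $r\ge 1$, let $u\in\mathfrak S_{r+1}$ be the element with reduced word $${\bf i}=(i_1,\dots,i_n)=(\underbrace{1,\dots,r}_{1\text{st cycle}},\underbrace{1,\dots,r-1}_{2\text{nd cycle}},\dots,\underbrace{1,\dots,r-m+2}_{(m-1)\text{th cycle}},\underbrace{1,\dots,i_n}_{m\text{th cycle}}),\qquad 1\le m\le r,\ 1\le i_n\le r-m+1 .$$ Let $1\le k\le n$, set $d:=i_k$, suppose that $d=i_k=i_n$, and suppose that the $k$-th index $i_k$ belongs to the $m'$-th cycle of ${\bf i}$. Put $$Y:=\frac{1}{\tau_{l_{m-1}+d}\,\tau_{l_{m-2}+d}\cdots\tau_{l_{m'}+d}}\in\mathcal Y$$ (with $Y=1$ if $m=m'$). Then $$\Delta^L(k;{\bf i})(\tau)=\sum_{x\in B^-_{u_{\le k}}((m'-m)\Lambda_d)}\mu_Y(x)=D^-_{u_{\le k}}[(m'-m)\Lambda_d,Y;{\bf 1}].$$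
   Context: **Indices.** $l_0:=0$ and $l_s:=\sum_{q=1}^{s}(r-q+1)$; the $(l_s+j)$-th index of ${\bf i}$ is $j$ and lies in the $(s+1)$-th cycle. Convention: $\tau_{l_s+0}=1$ (and $\tau_{l_s+(r+1)}=1$), where ''$l_s+j$'' is read as the pair $(s,j)$. **Generalized minors.** $G=\mathrm{SL}_{r+1}(\mathbb C)$, with Weyl group $\mathfrak S_{r+1}$ generated by $s_i=(i\ i{+}1)$. For $1\le i\le r$, $t\in\mathbb C^\times$, $x_{-i}(t)\in G$ is the identity matrix with the $2\times2$ block in rows and columns $i,i+1$ replaced by $\begin{pmatrix}t^{-1}&0\\1&t\end{pmatrix}$. Put $x^L_{\bf i}(\tau_1,\dots,\tau_n)=x_{-i_1}(\tau_1)\cdots x_{-i_n}(\tau_n)$ and $u_{\le k}=s_{i_1}\cdots s_{i_k}$. For $x\in G$, $\Delta(k;{\bf i})(x)$ is the minor of $x$ with rows $u_{\le k}(\{1,\dots,i_k\})$ and columns $\{1,\dots,i_k\}$. Finally $\Delta^L(k;{\bf i})(\tau):=\Delta(k;{\bf i})(x^L_{\bf i}(\tau))$, $\tau=(\tau_1,\dots,\tau_n)$, a Laurent polynomial in $\tau_1,\dots,\tau_n$. **Monomial crystal.** Let $I=\{1,\dots,r\}$, $A=(a_{ij})$ the Cartan matrix of type $A_r$, with simple roots $\alpha_i$, coroots $h_i$, fundamental weights $\Lambda_i$ and weight lattice $P$. Let $\mathcal Y$ be the set of Laurent monomials $\prod_{s\in\mathbb Z,i\in I}Y_{s,i}^{\zeta_{s,i}}$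 (finitely many nonzero $\zeta_{s,i}\in\mathbb Z$) in variables $Y_{s,i}$. The variable $Y_{s,j}$ is written $\tau_{l_s+j}$ for $0\le s\le r-1$, $1\le j\le r-s$. For $Z=\prod Y_{s,i}^{\zeta_{s,i}}$ put $$\mathrm{wt}(Z)=\sum_{i,s}\zeta_{s,i}\Lambda_i,\quad \varphi_i(Z)=\max\Big\{\sum_{k\le s}\zeta_{k,i}: s\in\mathbb Z\Big\},\quad \varepsilon_i(Z)=\varphi_i(Z)-\mathrm{wt}(Z)(h_i),$$ $$A_{s,i}=\frac{Y_{s,i}Y_{s+1,i}}{Y_{s,i+1}Y_{s+1,i-1}}\quad (Y_{s,0}=Y_{s,r+1}=1).$$ The Kashiwara operators are $\tilde f_iZ=A_{n_{f_i},i}^{-1}Z$ if $\varphi_i(Z)>0$ and $0$ otherwise; $\tilde e_iZ=A_{n_{e_i},i}Z$ if $\varepsilon_i(Z)>0$ and $0$ otherwise, where $n_{f_i}=\min\{n:\varphi_i(Z)=\sum_{k\le n}\zeta_{k,i}\}$, $n_{e_i}=\max\{n:\varphi_i(Z)=\sum_{k\le n}\zeta_{k,i}\}$. This makes $\mathcal Y$ a crystal; if $\varphi_i(Z)=0$ for all $i$, the connected component of $Z$ is isomorphic to $B^-(\mathrm{wt}(Z))$, the crystal base of the irreducible lowest weight $U_q(\mathfrak{sl}_{r+1})$-module with lowest weight $\mathrm{wt}(Z)$. For such $Z$, $\mu_Z:B^-(\mathrm{wt}(Z))\hookrightarrow\mathcal Y$ denotes the crystal embedding onto this component (the lowest weight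 vector goes to $Z$). **Lower Demazure crystals.** For $v_\lambda$ the lowest weight vector of $B^-(\lambda)$, $B^-_e(\lambda)=\{v_\lambda\}$ and, if $s_iw<w$, $B^-_w(\lambda)=\{\tilde e_i^kb: k\ge0,\ b\in B^-_{s_iw}(\lambda),\ \tilde f_ib=0\}\setminus\{0\}$. (Equivalently, for any reduced expression $w=s_{j_1}\cdots s_{j_p}$, $B^-_w(\lambda)=\{\tilde e_{j_1}^{c_1}\cdots\tilde e_{j_p}^{c_p}v_\lambda: c_q\ge0\}\setminus\{0\}$.) **Demazure polynomial.** For a lowest monomial $Y$ of weight $\lambda$ and coefficients $C=(c(b))$, $c(b)\in\mathbb Z_{>0}$, $D^-_w[\lambda,Y;C]=\sum_{b\in B^-_w(\lambda)}c(b)\mu_Y(b)$; ${\bf 1}$ means all $c(b)=1$. *)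

(* Defs.v *)
From HB Require Import structures.
From mathcomp Require Import all_boot all_order all_fingroup all_algebra.
From mathcomp Require Import boolp classical_sets reals complex freeg.

Set Implicit Arguments.
Unset Strict Implicit.
Unset Printing Implicit Defensive.

Import Order.TTheory GRing.Theory Num.Theory.
Local Open Scope ring_scope.

(* Conventions.  The letters of a word, the positions in a word and the cycles
   are natural numbers counted from 1, as in the paper.  The index set
   I = {1, ..., r} of the crystals is ['I_r], an ordinal [i] standing for the
   index [i.+1]; the set {1, ..., r+1} permuted by the Weyl group is
   ['I_r.+1], an ordinal [a] standing for [a.+1]. *)

Definition cycle_start (r s : nat) : nat := \sum_(1 <= q < s.+1) (r.+1 - q)%N.

Definition word (r m a : nat) : seq nat :=
  flatten [seq iota 1 (r - s) | s <- iota 0 m.-1] ++ iota 1 a.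

(* i_k, for 1 <= k <= n *)
Definition letter (w : seq nat) (k : nat) : nat := nth 0%N w k.-1.

Definition in_cycle (r m k : nat) : bool :=
  (cycle_start r m.-1 < k <= cycle_start r m)%N.

Definition srefl (r i : nat) : 'S_r.+1 := tperm (inord i.-1) (inord i).

(* MathComp's product of permutations is in diagrammatic order,
   (s * t)%g x = t (s x); the paper's product u v is thus (v * u)%g here. *)
Definition weyl_mul r (u v : 'S_r.+1) : 'S_r.+1 := (v * u)%g.

Definition weyl_word (r : nat) (w : seq nat) : 'S_r.+1 :=
  foldr (fun i u => weyl_mul (srefl r i) u) 1%g w.

Definition u_le (r : nat) (w : seq nat) (k : nat) : 'S_r.+1 :=
  weyl_word r (take k w).

Definition perm_length r (w : 'S_r.+1) : nat :=
  #|[set p : 'I_r.+1 * 'I_r.+1 | (p.1 < p.2)%N && (w p.2 < w p.1)%N]|.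

Definition xneg (F : fieldType) (r i : nat) (t : F) : 'M[F]_r.+1 :=
  \matrix_(a, b)
    if a == b then
      if a.+1 == i then t^-1 else if nat_of_ord a == i then t else 1
    else if (nat_of_ord a == i) && (b.+1 == i) then 1 else 0.

Definition xL (F : fieldType) (r : nat) (w : seq nat) (tau : nat -> F) :
    'M[F]_r.+1 :=
  \prod_(1 <= t < (size w).+1) xneg r (letter w t) (tau t).

(* The minor with rows R and columns C, both in increasing order (the order in
   which [enum] lists a set of ordinals); meant for #|R| = #|C|. *)
Definition minor (F : fieldType) r (A : 'M[F]_r.+1) (R C : {set 'I_r.+1}) : F :=
  \det (\matrix_(a < #|C|, b < #|C|)
          A (nth ord0 (enum R) a) (nth ord0 (enum C) b)).

Definition first_set (r d : nat) : {set 'I_r.+1} := [set a : 'I_r.+1 | (a < d)%N].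

Definition Delta (F : fieldType) r (w : seq nat) (k : nat) (x : 'M[F]_r.+1) : F :=
  minor x [set u_le r w k a | a in first_set r (letter w k)]
          (first_set r (letter w k)).

Definition DeltaL (F : fieldType) r (w : seq nat) (k : nat) (tau : nat -> F) : F :=
  Delta w k (xL r w tau).

(* a_ij, i.e. alpha_j(h_i) *)
Definition cartan r (i j : 'I_r) : int :=
  if i == j then 2 else if (i.+1 == j :> nat) || (j.+1 == i :> nat) then -1 else 0.

(* The weight lattice P, in coordinates with respect to the fundamental
   weights: [lam 0 i] is lam(h_i). *)
Definition weight (r : nat) : Type := 'rV[int]_r.

Definition fund_weight r (i : 'I_r) : 'rV[int]_r := delta_mx 0 i.

(* The extra element 0 of a crystal is [None]. *)
Record crystal (r : nat) (T : Type) := Crystal {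
  cwt : T -> weight r;
  ceps : 'I_r -> T -> int;
  cphi : 'I_r -> T -> int;
  ce : 'I_r -> T -> option T;
  cf : 'I_r -> T -> option T }.

Definition ce_pow r T (c : crystal r T) (i : 'I_r) (k : nat) (b : T) : option T :=
  iter k (obind (ce c i)) (Some b).

Definition cf_pow r T (c : crystal r T) (i : 'I_r) (k : nat) (b : T) : option T :=
  iter k (obind (cf c i)) (Some b).

Inductive connected r T (c : crystal r T) (z : T) : T -> Prop :=
| conn_refl : connected c z z
| conn_e i x y : connected c z x -> ce c i x = Some y -> connected c z y
| conn_f i x y : connected c z x -> cf c i x = Some y -> connected c z y.

Record crystal_embedding r T U (cT : crystal r T) (cU : crystal r U)
    (mu : T -> U) : Prop := CrystalEmbedding {
  emb_inj : injective mu;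
  emb_wt : forall b, cwt cU (mu b) = cwt cT b;
  emb_eps : forall i b, ceps cU i (mu b) = ceps cT i b;
  emb_phi : forall i b, cphi cU i (mu b) = cphi cT i b;
  emb_e : forall i b, ce cU i (mu b) = omap mu (ce cT i b);
  emb_f : forall i b, cf cU i (mu b) = omap mu (cf cT i b) }.

(* Laurent monomials in the Y_{s,i}, written additively: [coeff (s, i) Z] is
   the exponent of Y_{s,i+1} in Z. *)
Definition monomial (r : nat) := {freeg (int * 'I_r) / int}.

(* Y_{s,j} for a number j; it is the unit monomial unless 1 <= j <= r. *)
Definition Yvar (r : nat) (s : int) (j : nat) : monomial r :=
  \sum_(i < r | i.+1 == j) << 1 *g (s, i) >>.

Definition Avar (r : nat) (s : int) (i : nat) : monomial r :=
  Yvar r s i + Yvar r (s + 1) i - Yvar r s i.+1 - Yvar r (s + 1) i.-1.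

Definition Ywt r (Z : monomial r) : weight r :=
  \sum_(p <- dom Z) coeff p Z *: fund_weight p.2.

(* \sum_(k <= s) zeta_{k,i} *)
Definition Ypsum r (Z : monomial r) (i : 'I_r) (s : int) : int :=
  \sum_(p <- dom Z | (p.2 == i) && (p.1 <= s)) coeff p Z.

(* The maximum and minimum of a set of integers (0 if there is none). *)
Definition zmax (A : set int) : int :=
  xget 0 [set m | A m /\ forall n, A n -> n <= m]%classic.

Definition zmin (A : set int) : int :=
  xget 0 [set m | A m /\ forall n, A n -> m <= n]%classic.

Definition Yphi r (i : 'I_r) (Z : monomial r) : int :=
  zmax [set m | exists s, m = Ypsum Z i s]%classic.

Definition Yeps r (i : 'I_r) (Z : monomial r) : int := Yphi i Z - Ywt Z 0 i.

Definition Ynf r (i : 'I_r) (Z : monomial r) : int :=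
  zmin [set n | Yphi i Z = Ypsum Z i n]%classic.

Definition Yne r (i : 'I_r) (Z : monomial r) : int :=
  zmax [set n | Yphi i Z = Ypsum Z i n]%classic.

Definition Yf r (i : 'I_r) (Z : monomial r) : option (monomial r) :=
  if 0 < Yphi i Z then Some (Z - Avar r (Ynf i Z) i.+1) else None.

Definition Ye r (i : 'I_r) (Z : monomial r) : option (monomial r) :=
  if 0 < Yeps i Z then Some (Z + Avar r (Yne i Z) i.+1) else None.

Definition Ycrystal (r : nat) : crystal r (monomial r) :=
  Crystal (@Ywt r) (@Yeps r) (@Yphi r) (@Ye r) (@Yf r).

Definition laurent (r : nat) := {freeg (monomial r) / int}.

Definition mono (r : nat) (Z : monomial r) : laurent r := << 1 *g Z >>.

Definition mono_eval (F : fieldType) r (y : int -> 'I_r -> F) (Z : monomial r) : F :=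
  \prod_(p <- dom Z) (y p.1 p.2) ^ (coeff p Z).

Definition laurent_eval (F : fieldType) r (y : int -> 'I_r -> F)
    (D : laurent r) : F :=
  \sum_(Z <- dom D) (coeff Z D)%:~R * mono_eval y Z.

(* The tau_t are the Y_{s,j} with 0 <= s <= r-1 and 1 <= j <= r-s, where
   t = l_s + j; below j = i.+1. *)
Definition tau_are_Y (F : fieldType) r (tau : nat -> F) (y : int -> 'I_r -> F) :=
  forall (s : nat) (i : 'I_r), (i.+1 <= r - s)%N ->
    y s%:Z i = tau (cycle_start r s + i.+1)%N.

Definition Qq : fieldType := {fraction {poly rat}}.

Definition qq : Qq := tofrac 'X.

(* The local ring of rational functions in q that are regular at q = 0. *)
Definition regular0 (a : Qq) : Prop :=
  exists n d : {poly rat}, d.[0] != 0 /\ a = tofrac n / tofrac d.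

Definition qint (n : nat) : Qq := (qq ^+ n - qq ^- n) / (qq - qq^-1).

Definition qfact (n : nat) : Qq := \prod_(1 <= j < n.+1) qint j.

(* U_q(sl_{r+1})-modules: E i, F i and T i are the actions of e_i, f_i and
   q^{h_i}, and T' i that of the inverse of q^{h_i}. *)
Record uq_module r (V : vectType Qq) (E F T T' : 'I_r -> 'End(V)) : Prop :=
    UqModule {
  uq_TT' : forall i x, T i (T' i x) = x;
  uq_T'T : forall i x, T' i (T i x) = x;
  uq_TC : forall i j x, T i (T j x) = T j (T i x);
  uq_TE : forall i j x, T i (E j x) = qq ^ (cartan i j) *: E j (T i x);
  uq_TF : forall i j x, T i (F j x) = qq ^ (- cartan i j) *: F j (T i x);
  uq_EF : forall i j x, E i (F j x) - F j (E i x) =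
    if i == j then (qq - qq^-1)^-1 *: (T i x - T' i x) else 0;
  uq_serre0E : forall i j x, cartan i j = 0 -> E i (E j x) = E j (E i x);
  uq_serre0F : forall i j x, cartan i j = 0 -> F i (F j x) = F j (F i x);
  uq_serre1E : forall i j x, cartan i j = -1 ->
    E i (E i (E j x)) - (qq + qq^-1) *: E i (E j (E i x)) + E j (E i (E i x)) = 0;
  uq_serre1F : forall i j x, cartan i j = -1 ->
    F i (F i (F j x)) - (qq + qq^-1) *: F i (F j (F i x)) + F j (F i (F i x)) = 0 }.

Definition weight_vector r (V : vectType Qq) (T : 'I_r -> 'End(V))
    (lam : weight r) (x : V) : Prop :=
  forall i, T i x = qq ^ (lam 0 i) *: x.

(* v0 is a lowest weight vector of weight lam and V is irreducible. *)
Record irreducible_lowest_weight r (V : vectType Qq) (E F T T' : 'I_r -> 'End(V))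
    (lam : weight r) (v0 : V) : Prop := IrreducibleLowestWeight {
  ilw_neq0 : v0 != 0;
  ilw_weight : weight_vector T lam v0;
  ilw_lowest : forall i, F i v0 = 0;
  ilw_irreducible : forall U : {vspace V},
    (forall i x, x \in U ->
       [/\ E i x \in U, F i x \in U, T i x \in U & T' i x \in U]) ->
    U = 0%VS \/ U = fullv }.

(* f_i^(n) x, the divided power *)
Definition divF r (V : vectType Qq) (F : 'I_r -> 'End(V)) (i : 'I_r) (n : nat)
    (x : V) : V :=
  (qfact n)^-1 *: iter n (F i) x.

(* et i and ft i are Kashiwara's operators on V: every weight vector is a sum
   of vectors f_i^(n) x with x a weight vector killed by e_i, and the operators
   act on the nonzero f_i^(n) x by n |-> n - 1 and n |-> n + 1. *)
Definition kashiwara_operators r (V : vectType Qq) (E F T : 'I_r -> 'End(V))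
    (et ft : 'I_r -> 'End(V)) : Prop :=
  forall i n lam x, weight_vector T lam x -> E i x = 0 -> divF F i n x != 0 ->
    et i (divF F i n x) = (if n is n'.+1 then divF F i n' x else 0) /\
    ft i (divF F i n x) = divF F i n.+1 x.

(* L is a free module over the local ring at q = 0, spans V over Q(q), is the
   sum of its weight spaces and is stable under Kashiwara's operators. *)
Record crystal_lattice r (V : vectType Qq) (T : 'I_r -> 'End(V))
    (et ft : 'I_r -> 'End(V)) (L : V -> Prop) : Prop := CrystalLattice {
  lat_free : exists2 t : seq V, basis_of fullv t &
    forall x, L x <-> exists2 c : nat -> Qq, (forall i, regular0 (c i)) &
      x = \sum_(i < size t) c i *: t`_i;
  lat_weight : forall x, L x -> exists2 s : seq V, x = \sum_(z <- s) z &
    forall z, z \in s -> L z /\ exists lam, weight_vector T lam z;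
  lat_e : forall i x, L x -> L (et i x);
  lat_f : forall i x, L x -> L (ft i x) }.

Definition in_qL (V : vectType Qq) (L : V -> Prop) (x : V) : Prop :=
  exists2 z, L z & x = qq *: z.

(* (L, B) is a crystal base.  The set B of classes in L/qL is given through
   representatives [g b], chosen to be weight vectors. *)
Record crystal_base r (V : vectType Qq) (T : 'I_r -> 'End(V))
    (et ft : 'I_r -> 'End(V)) (L : V -> Prop) (B : finType) (cB : crystal r B)
    (g : B -> V) : Prop := CrystalBase {
  cb_lattice : crystal_lattice T et ft L;
  cb_in : forall b, L (g b);
  cb_basis : forall x, L x ->
    exists! c : {ffun B -> rat}, in_qL L (x - \sum_b tofrac (c b)%:P *: g b);
  cb_weight : forall b, weight_vector T (cwt cB b) (g b);
  cb_e : forall i b, in_qL L (et i (g b) - oapp g 0 (ce cB i b));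
  cb_f : forall i b, in_qL L (ft i (g b) - oapp g 0 (cf cB i b));
  cb_ef : forall i b b', cf cB i b = Some b' <-> ce cB i b' = Some b;
  cb_eps : forall i b (k : nat), ce_pow cB i k b <> None <-> (k%:Z <= ceps cB i b);
  cb_phi : forall i b (k : nat), cf_pow cB i k b <> None <-> (k%:Z <= cphi cB i b) }.

(* cB is B^-(lam), the crystal base of the irreducible lowest weight module of
   lowest weight lam, and v is its lowest weight vector v_lam. *)
Definition is_Bminus r (lam : weight r) (B : finType) (cB : crystal r B) (v : B) :
    Prop :=
  exists (V : vectType Qq) (E F T T' et ft : 'I_r -> 'End(V)) (v0 : V)
         (L : V -> Prop) (g : B -> V),
    [/\ uq_module E F T T', irreducible_lowest_weight E F T T' lam v0,
        kashiwara_operators E F T et ft, crystal_base T et ft L cB g &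
        L v0 /\ in_qL L (v0 - g v)].

(* mu is the embedding mu_Z of a crystal B with lowest weight vector v. *)
Record is_mu r (B : finType) (cB : crystal r B) (v : B) (Z : monomial r)
    (mu : B -> monomial r) : Prop := IsMu {
  mu_embedding : crystal_embedding cB (Ycrystal r) mu;
  mu_lowest : mu v = Z;
  mu_onto : forall Z', (exists b, mu b = Z') <-> connected (Ycrystal r) Z Z' }.

(* Bw is the family w |-> B^-_w(lambda); s_i w < w means that s_i w is shorter
   than w. *)
Record is_demazure r (B : finType) (cB : crystal r B) (v : B)
    (Bw : 'S_r.+1 -> {set B}) : Prop := IsDemazure {
  dem_1 : Bw 1%g = [set v];
  dem_rec : forall (w : 'S_r.+1) (i : 'I_r),
    (perm_length (weyl_mul (srefl r i.+1) w) < perm_length w)%N ->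
    forall x, x \in Bw w <->
      exists (k : nat) (b : B),
        [/\ b \in Bw (weyl_mul (srefl r i.+1) w), cf cB i b = None &
            ce_pow cB i k b = Some x] }.

(* D^-_w[lambda, Y; c], where mu is mu_Y *)
Definition demazure_poly r (B : finType) (Bw : 'S_r.+1 -> {set B})
    (mu : B -> monomial r) (w : 'S_r.+1) (c : B -> int) : laurent r :=
  \sum_(b in Bw w) << c b *g mu b >>.

Definition Ylowest (r m' m d : nat) : monomial r :=
  - \sum_(m' <= s < m) Yvar r s%:Z d.

(* Main.v *)
Require Import Defs.
From mathcomp Require Import all_boot all_order all_fingroup all_algebra.
From mathcomp Require Import boolp classical_sets reals complex freeg.
From mathcomp Require Import zify.

(* Multiplying by x_{-i}(t) on the left changes a minor by a row operation, so
   the minor is a sum over the ways in which D = d particles, starting at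
   1, ..., D, jump to m'+1, ..., m'+D while the letters of the word are read from
   right to left: at the letter i a particle sitting at i may jump to a vacant
   i+1.  Let g t j be the number of particles beyond position j before the
   cycles t, ..., 1 are read.  Then g determines the whole motion, the admissible
   g are cut out by local inequalities (the record [height_fn]), and the exponent
   of Y_{s,i} in the monomial of g is
     g (s+1) i + g s i - g s (i+1) - g (s+1) (i-1)   (this is [zeta g s i.-1]).
   Hence raising the single value g (s+1) i by 1 multiplies the monomial by
   A_{s,i}: the Kashiwara operators of the monomial crystal act on height
   functions by changing one value by 1, and the signature rule chooses exactly a
   value for which the inequalities survive.
   The Demazure crystal of the suffix of the word starting at the p-th letter of
   the (s+1)-th cycle is the set of height functions that take their least
   possible value on all cells attached to the earlier letters ([frozen]).
   Adding one letter i frees one value; if that value is not minimal, then the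
   partial sum of the exponents of Y_{0,i}, ..., Y_{s,i} equals its excess, so
   that phi_i > 0.  This is the recursion defining Demazure crystals. *)

Set Implicit Arguments.
Unset Strict Implicit.
Unset Printing Implicit Defensive.

Import Order.TTheory GRing.Theory Num.Theory.
Local Open Scope ring_scope.

(** * Minors and row operations *)

Lemma mul_xnegE (F : fieldType) r (i : 'I_r) (t : F) (A : 'M[F]_r.+1)
    (x b : 'I_r.+1) :
  (xneg r i.+1 t *m A) x b =
    if x == i :> nat then t^-1 * A x b
    else if x == i.+1 :> nat then A (inord i) b + t * A x b else A x b.
Proof.
rewrite mxE (bigD1 x) //= !mxE eqxx eqSS.
have i_lt : (i < r.+1)%N by rewrite ltnS ltnW.
have [x_hi|x_hi] := eqVneq (x : nat) i.+1; last first.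
  rewrite big1 ?addr0 => [|y /negbTE yx]; first by case: ifP; rewrite ?mul1r.
  by rewrite mxE eq_sym yx (negbTE x_hi) mul0r.
rewrite x_hi (gtn_eqF (ltnSn i)) (bigD1 (inord i)) /=; last first.
  by rewrite -val_eqE /= inordK // x_hi (ltn_eqF (ltnSn i)).
rewrite big1 ?addr0 => [|y /andP[/negbTE yx yi]].
  rewrite mxE eqSS inordK // x_hi !eqxx -val_eqE /= inordK // x_hi.
  by rewrite (gtn_eqF (ltnSn i)) /= mul1r addrC.
rewrite mxE eq_sym yx eqSS x_hi eqxx /=.
case: eqP => [yi'|]; last by rewrite mul0r.
by case/eqP: yi; apply: val_inj; rewrite /= inordK.
Qed.

Definition row_det (F : fieldType) r n (A : 'M[F]_r.+1)
    (f c : 'I_n -> 'I_r.+1) : F :=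
  \det (\matrix_(a, b) A (f a) (c b)).

Lemma det_scale_row (F : fieldType) n (A B : 'M[F]_n) (p : 'I_n) (c : F) :
  (forall a b, A a b = (if a == p then c else 1) * B a b) ->
  \det A = c * \det B.
Proof.
move=> AB; rewrite (@determinant_multilinear _ _ A B B p c 0) ?mul0r ?addr0 //.
- by apply/rowP=> b; rewrite !mxE AB eqxx mul0r addr0.
- by apply/matrixP=> a b; rewrite !mxE AB eq_sym (negbTE (neq_lift _ _)) mul1r.
- by apply/matrixP=> a b; rewrite !mxE AB eq_sym (negbTE (neq_lift _ _)) mul1r.
Qed.

Lemma row_det_xneg_none (F : fieldType) r n (i : 'I_r) (t : F) A
    (f c : 'I_n -> 'I_r.+1) :
  (forall a, f a != i :> nat) -> (forall a, f a != i.+1 :> nat) ->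
  row_det (xneg r i.+1 t *m A) f c = row_det A f c.
Proof.
move=> lo hi; congr (\det _); apply/matrixP=> a b.
by rewrite [LHS]mxE mul_xnegE (negbTE (lo a)) (negbTE (hi a)) mxE.
Qed.

Lemma row_det_xneg_lo (F : fieldType) r n (i : 'I_r) (t : F) A
    (f c : 'I_n -> 'I_r.+1) p :
  injective f -> f p = i :> nat -> (forall a, f a != i.+1 :> nat) ->
  row_det (xneg r i.+1 t *m A) f c = t^-1 * row_det A f c.
Proof.
move=> f_inj fp hi; apply: (@det_scale_row _ _ _ _ p) => a b.
rewrite mxE mul_xnegE (negbTE (hi a)) mxE -fp val_eqE (inj_eq f_inj).
by case: eqP => _; rewrite ?mul1r.
Qed.

Lemma row_det_xneg_hi (F : fieldType) r n (i : 'I_r) (t : F) A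
    (f f' c : 'I_n -> 'I_r.+1) q :
  injective f -> f q = i.+1 :> nat -> (forall a, f a != i :> nat) ->
  f' q = i :> nat -> (forall a, a != q -> f' a = f a) ->
  row_det (xneg r i.+1 t *m A) f c = row_det A f' c + t * row_det A f c.
Proof.
move=> f_inj fq lo f'q f'f; have i_lt : (i < r.+1)%N by rewrite ltnS ltnW.
have f_hi a : (f a == i.+1 :> nat) = (a == q).
  by rewrite -fq val_eqE (inj_eq f_inj).
have f'qE : f' q = inord i by apply: val_inj; rewrite /= inordK.
rewrite /row_det (@determinant_multilinear _ _ _
  (\matrix_(a, b) A (f' a) (c b)) (\matrix_(a, b) A (f a) (c b)) q 1 t) ?mul1r //.
- apply/rowP=> b; rewrite 2!mxE mul_xnegE (negbTE (lo q)) f_hi eqxx.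
  by rewrite !mxE f'qE mul1r.
- apply/matrixP=> a b; rewrite 4!mxE mul_xnegE (negbTE (lo _)) f_hi eq_sym.
  by rewrite (negbTE (neq_lift _ _)) f'f // eq_sym neq_lift.
- apply/matrixP=> a b; rewrite 4!mxE mul_xnegE (negbTE (lo _)) f_hi eq_sym.
  by rewrite (negbTE (neq_lift _ _)).
Qed.

(** Row [q] becomes row [i] of [A] plus [t] times row [i.+1]. By multilinearity the first part,
    proportional to row [p], contributes 0, and in the second [t] cancels the [t^-1] of row [p]. *)
Lemma row_det_xneg_both (F : fieldType) r n (i : 'I_r) (t : F) A
    (f c : 'I_n -> 'I_r.+1) p q :
  t != 0 -> injective f -> f p = i :> nat -> f q = i.+1 :> nat ->
  row_det (xneg r i.+1 t *m A) f c = row_det A f c.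
Proof.
move=> t0 f_inj fp fq; have i_lt : (i < r.+1)%N by rewrite ltnS ltnW.
have f_hi a : (f a == i.+1 :> nat) = (a == q).
  by rewrite -fq val_eqE (inj_eq f_inj).
have f_lo a : (f a == i :> nat) = (a == p).
  by rewrite -fp val_eqE (inj_eq f_inj).
have pq : q != p by apply/eqP=> qp; move: fq; rewrite qp fp; lia.
have fpE : f p = inord i by apply: val_inj; rewrite /= inordK.
pose B := \matrix_(a, b) ((if a == p then t^-1 else 1) * A (f a) (c b)).
pose C := \matrix_(a, b) ((if a == p then t^-1 else 1) *
                          A (if a == q then f p else f a) (c b)).
have detC : \det C = 0.
  rewrite (@det_scale_row _ _ C
    (\matrix_(a, b) A (if a == q then f p else f a) (c b)) p t^-1).
    rewrite (@determinant_alternate _ _ _ p q) ?mulr0 1?eq_sym // => b.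
    by rewrite !mxE eqxx; case: eqP.
  by move=> a b; rewrite !mxE.
have detB : \det B = t^-1 * row_det A f c.
  by apply: (@det_scale_row _ _ _ _ p) => a b; rewrite !mxE.
rewrite {1}/row_det (@determinant_multilinear _ _ _ C B q 1 t).
- by rewrite detC detB mulr0 add0r mulrA mulfV // mul1r.
- apply/rowP=> b; rewrite 2!mxE mul_xnegE f_lo f_hi (negbTE pq) eqxx.
  by rewrite !mxE (negbTE pq) eqxx -fpE !mul1r.
- apply/matrixP=> a b; rewrite 4!mxE mul_xnegE f_lo f_hi eq_sym.
  by rewrite [_ == q]eq_sym (negbTE (neq_lift _ _)); case: ifP; rewrite ?mul1r.
- apply/matrixP=> a b; rewrite 4!mxE mul_xnegE f_lo f_hi.
  by rewrite [_ == q]eq_sym (negbTE (neq_lift _ _)); case: ifP; rewrite ?mul1r.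
Qed.

(** * Row sets in increasing order *)

Lemma enum_ord_sorted n (J : {set 'I_n}) :
  sorted (fun x y : 'I_n => (x < y)%N) (enum J).
Proof.
rewrite /enum_mem -enumT; apply: sorted_filter.
  by move=> x y z; apply: ltn_trans.
by have := iota_ltn_sorted 0 n; rewrite -val_enum_ord sorted_map.
Qed.

Lemma enum_ord_eq n (J : {set 'I_n}) (s : seq 'I_n) :
  sorted (fun x y : 'I_n => (x < y)%N) s -> s =i J -> enum J = s.
Proof.
move=> s_sorted sJ; apply: (@irr_sorted_eq _ (fun x y : 'I_n => (x < y)%N)).
- by move=> x y z; apply: ltn_trans.
- by move=> x; apply: ltnn.
- exact: enum_ord_sorted.
- exact: s_sorted.
- by move=> x; rewrite mem_enum sJ.
Qed.

(** The expansion peels letters off the left end of the word, hence runs the motion of the particles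
    backwards: a jump from [i] to [i.+1] is undone. *)
Definition lower_set r (i : 'I_r) (J : {set 'I_r.+1}) : {set 'I_r.+1} :=
  [set x : 'I_r.+1 | (x == i :> nat) || ((x \in J) && (x != i.+1 :> nat))].

(** Since [i] is vacant and adjacent to [i.+1], the replacement keeps the enumeration increasing;
    hence no sign enters the minor. *)
Lemma enum_lower_set r (i : 'I_r) (J : {set 'I_r.+1}) :
  inord i \notin J -> inord i.+1 \in J ->
  enum (lower_set i J) =
    [seq if x == i.+1 :> nat then inord i else x | x : 'I_r.+1 <- enum J].
Proof.
move=> loJ hiJ; have i_lt : (i < r.+1)%N by rewrite ltnS ltnW.
have hi_lt : (i.+1 < r.+1)%N by rewrite ltnS.
have notlo (x : 'I_r.+1) : x \in J -> x != i :> nat.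
  apply: contraTneq => xi; rewrite (_ : x = inord i) //.
  by apply: val_inj; rewrite /= inordK.
apply: enum_ord_eq.
  rewrite sorted_map.
  apply: (sub_in_sorted (P := mem J) _ _ (enum_ord_sorted J)).
    move=> x y /= /notlo xlo /notlo ylo /= xy.
    by case: eqP => [xi|_]; case: eqP => [yi|_] /=; rewrite ?inordK //; lia.
  by apply/allP=> x; rewrite mem_enum.
move=> x; rewrite inE; apply/mapP/orP.
  case=> y; rewrite mem_enum => yJ ->; case: (boolP (y == _ :> nat)) => yi.
    by left; rewrite inordK.
  by right; rewrite yJ.
case=> [/eqP xi|/andP[xJ /negbTE xi]].
  exists (inord i.+1); first by rewrite mem_enum.
  by rewrite inordK // eqxx; apply: val_inj; rewrite /= inordK.
by exists x; rewrite ?mem_enum // xi.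
Qed.

Lemma card_lower_set r (i : 'I_r) (J : {set 'I_r.+1}) :
  inord i \notin J -> inord i.+1 \in J -> #|lower_set i J| = #|J|.
Proof.
by move=> loJ hiJ; rewrite cardE enum_lower_set // size_map -cardE.
Qed.

(** Only rows [i] and [i.+1] are changed, so all depends on which of them lie in [J]; the four row
    lemmas are the four cases. *)
Lemma minor_xneg (F : fieldType) r (i : 'I_r) (t : F) A (J C : {set 'I_r.+1}) :
  t != 0 -> #|J| = #|C| ->
  minor (xneg r i.+1 t *m A) J C =
    t ^ ((inord i.+1 \in J)%:Z - (inord i \in J)%:Z) * minor A J C +
    (if (inord i \notin J) && (inord i.+1 \in J)
     then minor A (lower_set i J) C else 0).
Proof.
move=> t0 JC; have i_lt : (i < r.+1)%N by rewrite ltnS ltnW.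
have hi_lt : (i.+1 < r.+1)%N by rewrite ltnS.
pose f (a : 'I_#|C|) := nth ord0 (enum J) a.
pose c (a : 'I_#|C|) := nth ord0 (enum C) a.
have sizeJ : size (enum J) = #|C| by rewrite -cardE JC.
have minorE B : minor B J C = row_det B f c by [].
have fJ a : f a \in J by rewrite -mem_enum mem_nth // sizeJ.
have f_inj : injective f.
  move=> a b /eqP; rewrite /f nth_uniq ?enum_uniq ?sizeJ // => /eqP ab.
  exact: val_inj.
have f_ex x : x \in J -> exists a, f a = x.
  rewrite -mem_enum => /[dup] xJ; rewrite -index_mem sizeJ => xlt.
  by exists (Ordinal xlt); rewrite /f nth_index.
have f_no k x : (k < r.+1)%N -> inord k \notin J -> f x != k :> nat.
  move=> k_lt; apply: contraNneq => fk; rewrite (_ : inord k = f x) //.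
  by apply: val_inj; rewrite /= inordK.
rewrite !minorE.
case: (boolP (inord i \in J)) => loJ; case: (boolP (inord i.+1 \in J)) => hiJ /=.
- have [p fp] := f_ex _ loJ; have [q fq] := f_ex _ hiJ.
  rewrite (@row_det_xneg_both _ _ _ _ _ _ _ _ p q) ?fp ?fq ?inordK //.
  by rewrite subrr expr0z mul1r addr0.
- have [p fp] := f_ex _ loJ.
  rewrite (@row_det_xneg_lo _ _ _ _ _ _ _ _ p) ?fp ?inordK //; first by rewrite addr0.
  by move=> a; apply: f_no.
- have [q fq] := f_ex _ hiJ.
  pose f' (a : 'I_#|C|) := nth ord0 (enum (lower_set i J)) a.
  have f'E a : f' a = if f a == i.+1 :> nat then inord i else f a.
    by rewrite /f' enum_lower_set // (nth_map ord0) // sizeJ.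
  rewrite (@row_det_xneg_hi _ _ _ _ _ _ _ f' _ q) ?f'E ?fq ?inordK ?eqxx //.
  + by rewrite addrC subr0 expr1z.
  + by move=> a; apply: f_no.
  + by rewrite inordK.
  move=> a aq; rewrite f'E ifN //; apply: contraNneq aq => fa.
  apply/eqP/f_inj; rewrite fq; apply: val_inj; rewrite /= inordK //.
- rewrite row_det_xneg_none ?subrr ?expr0z ?mul1r ?addr0 // => a; exact: f_no.
Qed.

Lemma minor1 (F : fieldType) r (J C : {set 'I_r.+1}) :
  #|J| = #|C| -> minor (1%:M : 'M[F]_r.+1) J C = (J == C)%:R.
Proof.
move=> JC; have [<-|nJC] := eqVneq J C.
  rewrite /minor (_ : \matrix_(_, _) _ = 1%:M) ?det1 //.
  apply/matrixP=> a b; rewrite !mxE; congr (_ %:R).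
  by rewrite nth_uniq ?enum_uniq -?cardE.
have [x xJ xC] : exists2 x, x \in J & x \notin C.
  by apply/subsetPn; apply: contra nJC => sJC; rewrite eqEcard sJC JC /=.
have xlt : (index x (enum J) < #|C|)%N by rewrite -JC cardE index_mem mem_enum.
rewrite /minor (expand_det_row _ (Ordinal xlt)) big1 // => b _.
rewrite !mxE nth_index ?mem_enum // (_ : _ == _ = false) ?mul0r //.
apply/negbTE; apply: contra xC => /eqP ->.
by rewrite -mem_enum mem_nth // -cardE.
Qed.

(** * Path expansion of minors *)

(** Cancellation may shrink the support of a sum, so sums over supports are compared on a common
    duplicate-free list. *)
Lemma big_dom (K : choiceType) (R : Type) (idx : R) (op : Monoid.com_law idx)
    (D : {freeg K / int}) (s : seq K) (F : K -> R) :
  uniq s -> {subset dom D <= s} -> (forall x, coeff x D = 0 -> F x = idx) ->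
  \big[op/idx]_(p <- dom D) F p = \big[op/idx]_(p <- s) F p.
Proof.
move=> s_uniq dom_s F0; rewrite [RHS](bigID [in dom D]) /= [X in op _ X]big1.
  rewrite Monoid.mulm1 -[RHS]big_filter; apply: perm_big; apply: uniq_perm.
  - exact: uniq_dom.
  - exact: filter_uniq.
  by move=> x; rewrite mem_filter; case: (boolP (x \in dom D)) => [/dom_s ->|].
by move=> x; rewrite mem_dom negbK => /eqP /F0.
Qed.

Lemma mono_evalD (F : fieldType) r (y : int -> 'I_r -> F) (Z1 Z2 : monomial r) :
  (forall s i, y s i != 0) ->
  mono_eval y (Z1 + Z2) = mono_eval y Z1 * mono_eval y Z2.
Proof.
move=> y0; pose s := undup (dom Z1 ++ dom Z2 ++ dom (Z1 + Z2)).
have sE Z : {subset dom Z <= s} -> mono_eval y Z = \prod_(p <- s) y p.1 p.2 ^ coeff p Z.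
  move=> sZ; apply: (@big_dom _ _ _ *%R Z s (fun p => y p.1 p.2 ^ coeff p Z)) => //.
    exact: undup_uniq.
  by move=> p ->.
rewrite !sE -?big_split /=.
- by apply: eq_bigr => p _; rewrite coeffD expfzDr.
- by move=> p pZ; rewrite mem_undup !mem_cat pZ ?orbT.
- by move=> p pZ; rewrite mem_undup !mem_cat pZ ?orbT.
- by move=> p pZ; rewrite mem_undup !mem_cat pZ ?orbT.
Qed.

Lemma mono_evalU (F : fieldType) r (y : int -> 'I_r -> F) k s i :
  mono_eval y << k *g (s, i) >> = y s i ^ k.
Proof.
have [->|k0] := eqVneq k 0; last by rewrite /mono_eval domU // big_seq1 coeffU eqxx mulr1.
by rewrite freegU0 /mono_eval dom0 big_nil.
Qed.

Lemma mono_eval0 (F : fieldType) r (y : int -> 'I_r -> F) : mono_eval y 0 = 1.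
Proof. by rewrite /mono_eval dom0 big_nil. Qed.

Lemma laurent_eval_sum (F : fieldType) r (y : int -> 'I_r -> F)
    (s : seq (monomial r)) :
  laurent_eval y (\sum_(Z <- s) mono Z) = \sum_(Z <- s) mono_eval y Z.
Proof.
have evalE D (t : seq (monomial r)) : uniq t -> {subset dom D <= t} ->
    laurent_eval y D = \sum_(Z <- t) (coeff Z D)%:~R * mono_eval y Z.
  move=> t_uniq tD.
  apply: (@big_dom _ _ _ +%R D t (fun Z => (coeff Z D)%:~R * mono_eval y Z)) => //.
  by move=> Z ->; rewrite mul0r.
elim: s => [|Z s IHs]; first by rewrite !big_nil /laurent_eval dom0 big_nil.
rewrite !big_cons -IHs; set D := \sum_(_ <- s) _.
pose t := undup (Z :: dom D ++ dom (mono Z + D)).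
have t_uniq : uniq t by apply: undup_uniq.
rewrite !(evalE _ t) //; first last.
- by move=> p pZ; rewrite mem_undup inE mem_cat pZ ?orbT.
- by move=> p pZ; rewrite mem_undup inE mem_cat pZ ?orbT.
have tZ : Z \in t by rewrite mem_undup mem_head.
transitivity (\sum_(i <- t) ((i == Z)%:R * mono_eval y i + (coeff i D)%:~R * mono_eval y i)).
  apply: eq_bigr => p _; rewrite coeffD /mono coeffU mul1r intrD mulrDl.
  by rewrite eq_sym; case: eqP.
rewrite big_split /=; congr (_ + _).
rewrite (bigD1_seq Z) //= eqxx mul1r big1 ?addr0 // => p /negbTE ->.
by rewrite mul0r.
Qed.

(** * Minors as sums over walks *)

Definition stairs (H : nat -> int) : Prop :=
  forall j, H j.+1 <= H j <= H j.+1 + 1.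

Definition steps r (H : nat -> int) : {set 'I_r.+1} :=
  [set x : 'I_r.+1 | H x != H x.+1].

Definition lower_height (H : nat -> int) (j : nat) : nat -> int :=
  fun i => H i - (i == j)%:Z.

(* The monomials of the minor with rows [steps r H] and columns 1, ..., D: H j is
   the number of rows beyond j.  A cell (s, i) stands for the letter i.+1 in the
   (s+1)-th cycle, hence for Y_{s,i+1}. *)
Fixpoint walks r (D : nat) (w : seq (nat * 'I_r)) (H : nat -> int) :
    seq (monomial r) :=
  match w with
  | [::] => if steps r H == first_set r D then [:: 0] else [::]
  | (s, i) :: w' =>
      [seq << (H i.+1 + H i.+1 - H i.+2 - H i) *g (s%:Z, i) >> + Z |
         Z <- walks D w' H] ++
      (if (H i == H i.+1) && (H i.+1 != H i.+2)
       then walks D w' (lower_height H i.+1) else [::])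
  end.

Lemma stairs_lower (H : nat -> int) i :
  stairs H -> H i = H i.+1 -> H i.+1 != H i.+2 -> stairs (lower_height H i.+1).
Proof.
move=> Hst lo hi j; rewrite /lower_height; move: (Hst j) (Hst i.+1).
have [->|/eqP ji] := eqVneq j i.
  by rewrite (ltn_eqF (ltnSn i)) eqxx /= lo; lia.
rewrite eqSS; have [ij|/eqP ij] := eqVneq j i.+1.
  rewrite ij (gtn_eqF (ltnSn i)) /=; lia.
by case: eqP => //; lia.
Qed.

Lemma steps_lower r (H : nat -> int) (i : 'I_r) :
  stairs H -> H i = H i.+1 -> H i.+1 != H i.+2 ->
  steps r (lower_height H i.+1) = lower_set i (steps r H).
Proof.
move=> Hst lo hi; apply/setP=> x; rewrite !inE /lower_height eqSS.
move: (Hst i.+1) lo hi; have [-> |xi] := eqVneq (x : nat) i; first by lia.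
by have [-> |xi'] := eqVneq (x : nat) i.+1; [lia | rewrite andbT; lia].
Qed.

(** One use of [minor_xneg] per letter; the steps of [H] being 0 or 1, the exponent of [t] is the
    step at [i.+1] minus the step at [i]. *)
Lemma minor_walks (F : fieldType) r (D : nat) (y : int -> 'I_r -> F)
    (w : seq (nat * 'I_r)) (H : nat -> int) :
  (forall s i, y s i != 0) -> stairs H -> #|steps r H| = #|first_set r D| ->
  minor (\prod_(l <- w) xneg r l.2.+1 (y l.1%:Z l.2)) (steps r H) (first_set r D) =
    \sum_(Z <- walks D w H) mono_eval y Z.
Proof.
move=> y0; elim: w H => [|[s i] w IHw] H Hst HD /=.
  rewrite big_nil minor1 //; case: eqP => _; last by rewrite big_nil.
  by rewrite big_seq1 mono_eval0.
have i_lt : (i < r.+1)%N by rewrite ltnS ltnW.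
have lo_in : (inord i \in steps r H) = (H i != H i.+1) by rewrite inE inordK.
have hi_in : (inord i.+1 \in steps r H) = (H i.+1 != H i.+2).
  by rewrite inE inordK // ltnS.
rewrite big_cons minor_xneg //= IHw // big_cat big_map /= lo_in hi_in negbK.
congr (_ + _).
  rewrite big_distrr /=; apply: eq_bigr => Z _.
  rewrite mono_evalD // mono_evalU; congr (_ ^ _ * _).
  by move: (Hst i) (Hst i.+1); lia.
case: ifP => [/andP[/eqP lo hi]|_]; last by rewrite big_nil.
rewrite -steps_lower // IHw //; first exact: stairs_lower.
rewrite steps_lower // card_lower_set ?lo_in ?hi_in ?hi //.
by rewrite lo eqxx.
Qed.

Lemma walks_outside r D (w : seq (nat * 'I_r)) H Z (s : nat) (i : 'I_r) :
  (s, i) \notin w -> Z \in walks D w H -> coeff (s%:Z, i) Z = 0.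
Proof.
elim: w H Z => [|[t j] w IHw] H Z /=.
  by move=> _; case: ifP => // _; rewrite inE => /eqP ->; rewrite coeff0.
rewrite inE negb_or => /andP[st sw]; rewrite mem_cat => /orP[].
  case/mapP=> Z' /(IHw _ _ sw) Z'0 ->; rewrite coeffD coeffU Z'0 addr0.
  rewrite (_ : _ == _ = false) ?mulr0 //; apply: contraNF st.
  by rewrite !xpair_eqE eqz_nat eq_sym => /andP[-> /eqP ->] /=.
by case: ifP => // _; apply: IHw.
Qed.

(** When both branches are open, the current cell has exponent 1 in the first and 0 in the second,
    because it does not recur in [w]. This is the source of the coefficients 1. *)
Lemma walks_uniq r D (w : seq (nat * 'I_r)) H :
  uniq w -> stairs H -> uniq (walks D w H).
Proof.
elim: w H => [|[s i] w IHw] H /=; first by case: ifP.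
case/andP=> si_w w_uniq Hst; rewrite cat_uniq; apply/and3P; split.
- by rewrite map_inj_uniq ?IHw //; apply: addrI.
- case: ifP => // /andP[/eqP lo hi]; apply/hasPn => Z Zw /=; apply/mapP => -[Z' Z'w ZE].
  move/(walks_outside si_w): Zw; rewrite ZE coeffD coeffU eqxx.
  rewrite (walks_outside si_w Z'w); move: (Hst i) (Hst i.+1) lo hi; lia.
- by case: ifP => // /andP[/eqP lo hi]; apply/IHw/stairs_lower.
Qed.

(** * Height functions *)

(** Two rows mix because, midway through a cycle, positions left of the current letter already carry
    row [s.+1] and those right of it still row [s]. *)
Definition zeta (g : nat -> nat -> int) (s i : nat) : int :=
  g s.+1 i.+1 + g s i.+1 - g s i.+2 - g s.+1 i.

(* The heights of the set of positions m'-t+1, ..., m'-t+D. *)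
Definition profile (D m' t j : nat) : int := (minn D (m' + D - (t + j)))%N%:Z.

(* The row t = m is the initial set of positions and t = 0 the final one. *)
Record height_fn (m m' D : nat) (g : nat -> nat -> int) : Prop := HeightFn {
  hf_top : forall j, g 0%N j = profile D m' 0 j;
  hf_bot : forall j, g m j = profile D m' m' j;
  hf_row : forall t, (t <= m)%N -> stairs (g t);
  hf_col : forall t j, (t < m)%N -> g t.+1 j <= g t j <= g t.+1 j + 1;
  hf_diag : forall t j, (t < m)%N -> g t j.+1 <= g t.+1 j }.

Definition path_monomial (r m : nat) (g : nat -> nat -> int) : monomial r :=
  \sum_(s < m) \sum_(i < r) << zeta g s i *g ((s : nat)%:Z, i) >>.

Definition row_cells r (d : 'I_r) (s p n : nat) : seq (nat * 'I_r) :=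
  [seq (s, insubd d j) | j <- iota p n].

(** The effect of a stretch of one cycle: [rs_col] reflects that each letter occurs once in it,
    [rs_diag] that no particle moves twice. *)
Record row_step (p n : nat) (H H' : nat -> int) : Prop := RowStep {
  rs_stairs : stairs H';
  rs_out : forall j, (j <= p)%N || (p + n < j)%N -> H' j = H j;
  rs_col : forall j, H' j <= H j <= H' j + 1;
  rs_diag : forall j, (p <= j)%N -> H j.+1 <= H' j }.

(** A letter either keeps the height at [p.+1] or lowers it by one, and no later letter of the
    stretch touches that value; so [H'] determines every branch. *)
Lemma mem_walks_row r D (d : 'I_r) s n p w' H Z :
  (p + n <= r)%N -> stairs H ->
  Z \in walks D (row_cells d s p n ++ w') H <->
  exists H' Z', [/\ row_step p n H H', Z' \in walks D w' H' &
    Z = \sum_(p <= j < p + n)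
          << (H' j.+1 + H j.+1 - H j.+2 - H' j) *g (s%:Z, insubd d j) >> + Z'].
Proof.
elim: n p H Z => [|n IHn] p H Z pn Hst.
  split=> [Zw|[H' [Z' [HH' Z'w ->]]]].
    exists H, Z; split=> //; last by rewrite addn0 big_geq ?add0r.
    by split=> // j; move: (Hst j); lia.
  rewrite addn0 big_geq ?add0r //= (_ : H = H') //.
  by apply/funext=> j; rewrite (rs_out HH') //; lia.
have dE : insubd d p = p :> nat by rewrite val_insubd; case: ifP; lia.
(* After the first letter is split off, the remaining terms read the old heights from [p.+2] on
   only, so a change at [p.+1] is invisible to them. *)
have sumE (H1 H' : nat -> int) (Z' : monomial r) :
  (forall j, j != p.+1 -> H1 j = H j) -> H' p = H p ->
  \sum_(p <= j < p + n.+1)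
    << (H' j.+1 + H j.+1 - H j.+2 - H' j) *g (s%:Z, insubd d j) >> + Z' =
  << (H' p.+1 + H p.+1 - H p.+2 - H p) *g (s%:Z, insubd d p) >> +
  (\sum_(p.+1 <= j < p.+1 + n)
    << (H' j.+1 + H1 j.+1 - H1 j.+2 - H' j) *g (s%:Z, insubd d j) >> + Z').
  move=> H1H H'p; rewrite addnS -addSn big_ltn ?leq_addr // -addrA H'p.
  congr (_ + (_ + _)); apply: eq_big_nat => j /andP[pj _].
  by rewrite !H1H //; lia.
rewrite /= mem_cat dE; split.
  case/orP=> [/mapP[Z1]|].
    case/IHn=> //; first by lia.
    move=> H' [Z' [HH' Z'w ->]] ->; exists H', Z'; split=> //.
      split; [exact: rs_stairs HH' | | exact: rs_col HH' |].
        by move=> j jp; apply: (rs_out HH'); lia.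
      move=> j; rewrite leq_eqVlt => /orP[/eqP <-|]; last exact: (rs_diag HH').
      by rewrite (rs_out HH') ?leqnSn //; move: (Hst p); lia.
    rewrite (sumE H) ?(rs_out HH') ?leqnn ?leqnSn //.
  case: ifP => // /andP[/eqP lo hi]; have H1st := stairs_lower Hst lo hi.
  case/IHn=> //; first by lia.
  move=> H' [Z' [HH' Z'w ->]]; exists H', Z'; split=> //.
    split.
    - exact: rs_stairs HH'.
    - move=> j jp; rewrite (rs_out HH'); last by lia.
      by rewrite /lower_height; case: eqP; lia.
    - move=> j; have [->|/eqP jp] := eqVneq j p.+1.
        by rewrite (rs_out HH') ?leqnn // /lower_height eqxx; lia.
      by have := rs_col HH' j; rewrite /lower_height; case: eqP => // _; lia.
    move=> j; rewrite leq_eqVlt => /orP[/eqP <-|pj].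
      rewrite (rs_out HH') ?leqnSn // /lower_height.
      by case: eqP; move: (Hst p); lia.
    by have := rs_diag HH' pj; rewrite /lower_height; case: eqP => //; lia.
  rewrite (sumE (lower_height H p.+1)).
  (* At a jump the uniform formula gives exponent 0, in agreement with the second branch of
     [walks]. *)
  + rewrite (rs_out HH') ?leqnn // /lower_height eqxx.
    by rewrite (_ : _ - _ - _ = 0) ?freegU0 ?add0r //; move: (Hst p.+1); lia.
  + by move=> j /negbTE jp; rewrite /lower_height jp subr0.
  rewrite (rs_out HH') ?leqnSn // /lower_height.
  by case: eqP => //; lia.
case=> H' [Z' [HH' Z'w ->]].
have H'p : H' p = H p by rewrite (rs_out HH') ?leqnn.
have := rs_stairs HH' p; have := rs_diag HH' (leqnSn p).
have := rs_col HH' p.+1; have := Hst p.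
have [Heq _ _ _ _|Hneq Hp colp diagp rowp] := eqVneq (H' p.+1) (H p.+1).
  apply/orP; left; apply/mapP; rewrite (sumE H) // Heq.
  eexists; last by [].
  apply/IHn => //; first by lia.
  exists H', Z'; split=> //; split; [exact: rs_stairs HH' | | exact: rs_col HH' |].
    move=> j; have [->//|jp] := eqVneq j p.+1.
    by move=> jpn; apply: (rs_out HH'); lia.
  by move=> j pj; apply: (rs_diag HH'); lia.
(* The jump is legal: the staircase [H'] forces [H] to be flat at [p], and the diagonal inequality
   forces a step of [H] at [p.+1]. *)
have lo : H p = H p.+1 by lia.
have hi : H p.+1 != H p.+2 by lia.
apply/orP; right; rewrite lo eqxx hi /=.
rewrite (sumE (lower_height H p.+1)) //; last first.
  by move=> j /negbTE jp; rewrite /lower_height jp subr0.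
rewrite (_ : _ - H p = 0) ?freegU0 ?add0r; last by move: (Hst p.+1); lia.
apply/IHn; [by lia | exact: stairs_lower |].
exists H', Z'; split=> //; split; first exact: rs_stairs HH'.
- move=> j jpn; rewrite /lower_height; case: eqP => [->|jp] /=; first by lia.
  by rewrite (rs_out HH') ?subr0 //; lia.
- move=> j; have := rs_col HH' j.
  by rewrite /lower_height; case: eqP => [->|jp] /=; lia.
move=> j pj; have := @rs_diag _ _ _ _ HH' j.
by rewrite /lower_height; case: eqP => //=; lia.
Qed.

Definition cells r (d : 'I_r) (L : nat -> nat) (s n : nat) : seq (nat * 'I_r) :=
  flatten [seq row_cells d t 0 (L t) | t <- iota s n].

Lemma mem_walks_cells r D (d : 'I_r) L s n H Z :
  (forall t, (L t <= r)%N) -> stairs H ->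
  Z \in walks D (cells d L s n) H <->
  exists g, [/\ g s = H,
    forall t, (s <= t < s + n)%N -> row_step 0 (L t) (g t) (g t.+1),
    steps r (g (s + n)%N) = first_set r D &
    Z = \sum_(s <= t < s + n) \sum_(0 <= j < L t)
          << zeta g t j *g (t%:Z, insubd d j) >>].
Proof.
move=> Lr; elim: n s H Z => [|n IHn] s H Z Hst.
  rewrite /= addn0; split=> [|[g [<- _ -> ->]]]; last first.
    by rewrite eqxx big_geq ?inE.
  case: eqP => // HD; rewrite inE => /eqP ->; exists (fun=> H); split=> //.
    by move=> t; lia.
  by rewrite big_geq.
rewrite [cells _ _ _ _]/= -/(cells d L s.+1 n); split.
  case/mem_walks_row; rewrite ?add0n // => H' [Z' [HH' ]].
  case/IHn; first exact: rs_stairs HH'.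
  move=> g [gs gstep gD ->] ->.
  exists (fun t => if t == s then H else g t); split.
  - by rewrite eqxx.
  - move=> t ts; have [->|tneq] := eqVneq t s.
      by rewrite gtn_eqF // gs; apply: HH'.
    by rewrite (ifN_eq _ _ (_ : t.+1 != s)); [apply: gstep; lia | lia].
  - by rewrite (_ : s + n.+1 == s = false)%N ?addnS -?addSn //; lia.
  rewrite [RHS]big_ltn; last by lia.
  congr (_ + _).
    by apply: eq_bigr => j _; rewrite /zeta eqxx gtn_eqF // gs.
  rewrite -(addSnnS s n); apply: eq_big_nat => t ts; apply: eq_bigr => j _.
  by rewrite /zeta !ifN //; lia.
case=> g [gs gstep gD ->]; apply/mem_walks_row; rewrite ?add0n //.
have st_s : (s <= s < s + n.+1)%N by lia.
exists (g s.+1); eexists; split; first by rewrite -gs; apply: gstep.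
  apply/IHn; first exact: (rs_stairs (gstep s st_s)).
  exists g; split=> //; first by move=> t ts; apply: gstep; lia.
  by rewrite addSnnS.
rewrite -gs [LHS]big_ltn ?addSnnS //; lia.
Qed.

Lemma height_fn_ge0 m m' D g t j :
  height_fn m m' D g -> (t <= m)%N -> 0 <= g t j.
Proof.
move=> gP tm; suff gm k : (k <= m)%N -> 0 <= g (m - k)%N j.
  by have := gm (m - t)%N; rewrite subKn // leq_subr => /(_ isT).
elim: k => [|k IHk] km; first by rewrite subn0 (hf_bot gP) /profile; lia.
have := @hf_col _ _ _ _ gP (m - k.+1)%N j; rewrite subnSK //.
by move: (IHk (ltnW km)); lia.
Qed.

(** Row [m] vanishes from [D] on, and by [hf_diag] the front advances by at most one position per
    cycle. *)
Lemma height_fn_out m m' D g t j :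
  height_fn m m' D g -> (t <= m)%N -> (D + m - t <= j)%N -> g t j = 0.
Proof.
move=> gP tm; suff gm k i : (k <= m)%N -> (D + k <= i)%N -> g (m - k)%N i <= 0.
  move=> tj; apply/le_anti; rewrite (height_fn_ge0 _ gP) // andbT.
  have := gm (m - t)%N j; rewrite subKn // leq_subr; apply=> //; lia.
elim: k i => [|k IHk] i km ki; first by rewrite subn0 (hf_bot gP) /profile; lia.
case: i ki => [|i] ki; first by lia.
have := @hf_diag _ _ _ _ gP (m - k.+1)%N i; rewrite subnSK //.
by have := IHk i (ltnW km); lia.
Qed.

Lemma height_fn_left m m' D g t :
  height_fn m m' D g -> (t <= m)%N -> g t 0%N = D%:Z.
Proof.
move=> gP tm; apply/le_anti/andP; split.
  elim: t tm => [|t IHt] tm; first by rewrite (hf_top gP) /profile; lia.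
  by have := hf_col gP 0%N tm; have := IHt (ltnW tm); lia.
suff gm k : (k <= m)%N -> D%:Z <= g (m - k)%N 0%N.
  by have := gm (m - t)%N; rewrite subKn // leq_subr => /(_ isT).
elim: k => [|k IHk] km; first by rewrite subn0 (hf_bot gP) /profile; lia.
have := @hf_col _ _ _ _ gP (m - k.+1)%N 0%N; rewrite subnSK //.
by move: (IHk (ltnW km)); lia.
Qed.

Lemma stairs_profile D m' t : stairs (profile D m' t).
Proof. by move=> j; rewrite /profile; lia. Qed.

Lemma steps_bottom r D m' (H : nat -> int) :
  (D <= r.+1)%N -> stairs H -> (forall j, (r < j)%N -> H j = 0) ->
  steps r H = first_set r D -> forall j, H j = profile D m' m' j.
Proof.
move=> Dr Hst H0 HD.
suff Hk k : (k <= r.+1)%N -> H (r.+1 - k)%N = profile D m' m' (r.+1 - k).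
  move=> j; have [rj|rj] := leqP r.+1 j; first by rewrite H0 // /profile; lia.
  by rewrite -(subKn (ltnW rj)) Hk // leq_subr.
elim: k => [|k IHk] kr; first by rewrite subn0 H0 // /profile; lia.
have := Hst (r.+1 - k.+1)%N; rewrite subnSK // (IHk (ltnW kr)).
have jr : (r.+1 - k.+1 < r.+1)%N by lia.
have /setP/(_ (Ordinal jr)) := HD; rewrite !inE /= subnSK // (IHk (ltnW kr)).
by rewrite /profile; lia.
Qed.

(** Chained row steps with both end rows prescribed are the axioms of [height_fn]. Past the length
    [L t] all heights entering [zeta] vanish, so the sums extend to the whole of ['I_r]. *)
Lemma mem_walks_path r m m' D (d : 'I_r) (L : nat -> nat) Z :
  (m' + D <= r.+1)%N -> (forall t, (L t <= r)%N) ->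
  (forall t, (t < m)%N -> (D + m - t.+1 <= L t)%N) ->
  Z \in walks D (cells d L 0 m) (profile D m' 0) <->
  exists2 g, height_fn m m' D g & Z = path_monomial r m g.
Proof.
move=> m'D Lr Lge.
have sumE (g : nat -> nat -> int) :
    (forall t j, (t < m)%N -> (L t <= j)%N -> zeta g t j = 0) ->
    \sum_(0 <= t < 0 + m) \sum_(0 <= j < L t)
      << zeta g t j *g (t%:Z, insubd d j) >> = path_monomial r m g.
  move=> g0; rewrite add0n big_mkord; apply: eq_bigr => t _.
  rewrite big_mkord (big_ord_widen_cond r xpredT
    (fun j => << zeta g t j *g ((t : nat)%:Z, insubd d j) >>)) ?Lr // big_mkcond /=.
  apply: eq_bigr => i _; rewrite valKd; case: ltnP => // Li.
  by rewrite g0 // freegU0.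
split.
  case/mem_walks_cells=> //; first exact: stairs_profile.
  move=> g [g0 gstep gD ->].
  have gst t : (t <= m)%N -> stairs (g t).
    case: t => [|t] tm; first by rewrite g0; apply: stairs_profile.
    exact: (rs_stairs (gstep t tm)).
  have gout t j : (t <= m)%N -> (r < j)%N -> g t j = 0.
    move=> tm rj; elim: t tm => [|t IHt] tm; first by rewrite g0 /profile; lia.
    rewrite -(IHt (ltnW tm)); apply: (rs_out (gstep t tm)); rewrite add0n.
    by rewrite (leq_ltn_trans (Lr t)) ?orbT.
  have gP : height_fn m m' D g.
    split=> //.
    - by move=> j; rewrite g0.
    - apply: (@steps_bottom r) => //; [by lia | exact: gst | move=> j; exact: gout].
    - by move=> t j tm; apply: (rs_col (gstep t tm)).
    - by move=> t j tm; apply: (rs_diag (gstep t tm)).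
  exists g => //; apply: sumE => t j tm Lj; rewrite /zeta.
  have := Lge t tm => Lt.
  by rewrite !(height_fn_out gP) //; lia.
case=> g gP ->; apply/mem_walks_cells => //; first exact: stairs_profile.
exists g; split.
- by apply/funext => j; rewrite (hf_top gP).
- move=> t; rewrite add0n => tm; split.
  + exact: (hf_row gP).
  + move=> j /orP[|jL]; first by rewrite leqn0 => /eqP ->; rewrite !(height_fn_left gP) // ltnW.
    by have := Lge t tm => Lt; rewrite !(height_fn_out gP) //; lia.
  + by move=> j; apply: (hf_col gP).
  by move=> j _; apply: (hf_diag gP).
- apply/setP=> x; rewrite !inE !(hf_bot gP) /profile; lia.
rewrite sumE // => t j tm Lj; have := Lge t tm => Lt.
by rewrite /zeta !(height_fn_out gP) //; lia.
Qed.

(** * Kashiwara operators on height functions *)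

Lemma zmax_eq (A : set int) (x : int) :
  A x -> (forall n, A n -> n <= x) -> zmax A = x.
Proof.
move=> Ax xA; rewrite /zmax; case: xgetP => [y _ [Ay yA]|/(_ x) []//].
by apply/le_anti; rewrite xA // yA.
Qed.

Lemma zmin_eq (A : set int) (x : int) :
  A x -> (forall n, A n -> x <= n) -> zmin A = x.
Proof.
move=> Ax xA; rewrite /zmin; case: xgetP => [y _ [Ay yA]|/(_ x) []//].
by apply/le_anti; rewrite yA // xA.
Qed.

Lemma coeff_path_monomial r m g (s : int) (i : 'I_r) :
  coeff (s, i) (path_monomial r m g) =
    \sum_(t < m) if (t : nat)%:Z == s then zeta g t i else 0.
Proof.
rewrite /path_monomial raddf_sum; apply: eq_bigr => t _.
rewrite raddf_sum (bigD1 i) //= coeffU xpair_eqE eqxx andbT.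
rewrite big1 ?addr0 => [|j /negbTE ji]; first by case: eqP; rewrite ?mulr1 ?mulr0.
by rewrite coeffU xpair_eqE ji andbF mulr0.
Qed.

Lemma coeff_path_monomial_nat r m g (s : nat) (i : 'I_r) :
  coeff (s%:Z, i) (path_monomial r m g) = if (s < m)%N then zeta g s i else 0.
Proof.
rewrite coeff_path_monomial; case: ltnP => sm.
  rewrite (bigD1 (Ordinal sm)) //= eqxx big1 ?addr0 // => t ts.
  by rewrite ifN // eqz_nat; apply: contra ts => /eqP ts; apply/eqP/val_inj.
rewrite big1 // => t _; rewrite ifN // eqz_nat; have := ltn_ord t; lia.
Qed.

(** * Partial sums of exponents and the signature rule *)

Lemma big_path_monomial r m g (P : pred (int * 'I_r)) :
  \sum_(p <- dom (path_monomial r m g) | P p) coeff p (path_monomial r m g) =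
  \sum_(s < m) \sum_(i < r | P ((s : nat)%:Z, i)) zeta g s i.
Proof.
set Z := path_monomial r m g.
pose cs := [seq ((s : nat)%:Z, i) | s : 'I_m <- enum 'I_m, i <- enum 'I_r].
have cs_uniq : uniq cs.
  apply: allpairs_uniq; rewrite ?enum_uniq // => -[s i] [t j] _ _ /= [].
  by move=> /val_inj -> ->.
rewrite big_mkcond (@big_dom _ _ _ +%R Z cs (fun p => if P p then coeff p Z else 0)) //.
- rewrite big_allpairs_dep big_enum; apply: eq_bigr => s _.
  rewrite big_enum [RHS]big_mkcond; apply: eq_bigr => i _.
  by rewrite coeff_path_monomial_nat ltn_ord.
- case=> s i; rewrite mem_dom coeff_path_monomial => nz.
  have [t _ /eqP ts] : exists2 t : 'I_m, true & (t : nat)%:Z == s.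
    apply/exists_inP; apply: contraNT nz => /exists_inPn ns.
    by rewrite big1 // => t _; rewrite (negbTE (ns t _)).
  by apply/allpairsP; exists (t, i); rewrite !mem_enum /= ts.
by move=> p ->; case: ifP.
Qed.

(** Indexed by the number of terms: the sum ending at row [s] has index [s.+1], and index 0 is the
    empty sum seen at negative bounds. Hence the shifts [k%:Z - 1] below. *)
Definition partial_zeta (g : nat -> nat -> int) (i k : nat) : int :=
  \sum_(0 <= s < k) zeta g s i.

(* The number of s < m with s <= n. *)
Definition clamp (m : nat) (n : int) : nat :=
  if n < 0 then 0%N else minn m `|n|.+1.

Lemma Ypsum_path r m g (i : 'I_r) n :
  Ypsum (path_monomial r m g) i n = partial_zeta g i (clamp m n).
Proof.
rewrite /Ypsum big_path_monomial /partial_zeta.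
transitivity (\sum_(s < m | (s : nat)%:Z <= n) zeta g s i).
  rewrite [RHS]big_mkcond; apply: eq_bigr => s _ /=; case: ifP => sn.
    by rewrite (big_pred1 i) // => j; rewrite andbT.
  by rewrite big_pred0 // => j; rewrite andbF.
rewrite -(big_mkord (fun s => s%:Z <= n) (fun s => zeta g s i)).
have clm : (clamp m n <= m)%N by rewrite /clamp; case: ifP; lia.
rewrite (big_cat_nat (n := clamp m n)) //= [X in _ + X]big_nat_cond [X in _ + X]big1.
  rewrite addr0 big_nat_cond [RHS]big_nat_cond; apply: eq_bigl => s.
  by rewrite /clamp; case: ifP; lia.
by move=> s; rewrite /clamp; case: ifP; lia.
Qed.

Lemma Ywt_path r m g (i : 'I_r) :
  Ywt (path_monomial r m g) 0 i = partial_zeta g i m.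
Proof.
rewrite /Ywt summxE.
transitivity (\sum_(p <- dom (path_monomial r m g) | p.2 == i)
                coeff p (path_monomial r m g)).
  rewrite [RHS]big_mkcond; apply: eq_bigr => p _.
  by rewrite !mxE eqxx eq_sym /=; case: eqP => _; rewrite ?mulr1 ?mulr0.
rewrite big_path_monomial /partial_zeta big_mkord; apply: eq_bigr => s _.
by rewrite big_pred1_eq.
Qed.

Lemma Yphi_path r m g (i : 'I_r) k :
  (k <= m)%N ->
  (forall l, (l <= m)%N -> partial_zeta g i l <= partial_zeta g i k) ->
  Yphi i (path_monomial r m g) = partial_zeta g i k.
Proof.
move=> km kmax; apply: zmax_eq.
  exists (k%:Z - 1); rewrite Ypsum_path; congr partial_zeta.
  by rewrite /clamp; case: ifP; lia.
move=> _ [n ->]; rewrite Ypsum_path; apply: kmax.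
by rewrite /clamp; case: ifP; lia.
Qed.

Lemma partial_zeta_max g i m : exists2 k, (k <= m)%N &
  forall l, (l <= m)%N -> partial_zeta g i l <= partial_zeta g i k.
Proof.
case: (@Order.TotalTheory.arg_maxP _ _ _ (ord0 : 'I_m.+1) xpredT
  (fun k : 'I_m.+1 => partial_zeta g i k) isT) => k _ kmax.
exists k => [|l lm]; first by rewrite -ltnS.
exact: (kmax (Ordinal (lm : (l < m.+1)%N)) isT).
Qed.

Lemma Yphi_path_ge r m g (i : 'I_r) k :
  (k <= m)%N -> partial_zeta g i k <= Yphi i (path_monomial r m g).
Proof.
have [l lm lmax] := partial_zeta_max g i m.
by move=> km; rewrite (Yphi_path lm lmax) lmax.
Qed.

(** Here [k] is the last maximum of the partial sums; as [k < m], the full sum, which is the weight,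
    lies below it and [Yeps] is positive. *)
Lemma Ye_path r m g (i : 'I_r) k :
  (k < m)%N ->
  (forall l, (l <= k)%N -> partial_zeta g i l <= partial_zeta g i k) ->
  (forall l, (k < l <= m)%N -> partial_zeta g i l < partial_zeta g i k) ->
  Ye i (path_monomial r m g) =
    Some (path_monomial r m g + Avar r (k%:Z - 1) i.+1).
Proof.
move=> km kle klt.
have kmax l : (l <= m)%N -> partial_zeta g i l <= partial_zeta g i k.
  by move=> lm; have [/kle //|kl] := leqP l k; apply/ltW/klt; rewrite kl.
have phiE := Yphi_path (ltnW km) kmax.
rewrite /Ye /Yeps phiE Ywt_path subr_gt0 klt ?km ?leqnn //.
congr (Some (_ + Avar _ _ _)); rewrite /Yne phiE; apply: zmax_eq.
  rewrite /= Ypsum_path; congr partial_zeta.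
  by rewrite /clamp; case: ifP; lia.
move=> n /=; rewrite Ypsum_path => kE; have : ~~ (k < clamp m n <= m)%N.
  by apply/negP => /klt; rewrite kE ltxx.
by rewrite /clamp; case: ifP; lia.
Qed.

Lemma Ye_path_inv r m g (i : 'I_r) Z :
  Ye i (path_monomial r m g) = Some Z ->
  exists k, [/\ (k < m)%N, zeta g k i < 0, (forall l, k = l.+1 -> 0 <= zeta g l i) &
    Z = path_monomial r m g + Avar r (k%:Z - 1) i.+1].
Proof.
have [k0 k0m k0max] := partial_zeta_max g i m.
move=> YeE; have : 0 < Yeps i (path_monomial r m g) by move: YeE; rewrite /Ye; case: ifP.
rewrite /Yeps (Yphi_path k0m k0max) Ywt_path subr_gt0 => mk0.
pose P k := (k <= m)%N && (partial_zeta g i k == partial_zeta g i k0).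
have exP : exists k, P k by exists k0; rewrite /P k0m eqxx.
have Pm k : P k -> (k <= m)%N by case/andP.
case: (ex_maxnP exP Pm) => k /andP[km /eqP kE] kmax.
have {}km : (k < m)%N.
  by rewrite ltn_neqAle km andbT; apply: contraTneq mk0 => <-; rewrite kE ltxx.
have klt l : (k < l <= m)%N -> partial_zeta g i l < partial_zeta g i k.
  case/andP=> kl lm; rewrite kE lt_neqAle k0max // andbT.
  by apply: contraTN kl => lE; rewrite -leqNgt; apply: kmax; rewrite /P lm.
exists k; split=> //.
- have := klt k.+1; rewrite ltnSn km => /(_ isT).
  by rewrite /partial_zeta big_nat_recr //= gtrDl.
- move=> l lE; have := k0max l; rewrite -kE lE /partial_zeta big_nat_recr //=.
  by rewrite lerDl; apply; lia.
have := YeE; rewrite (@Ye_path _ _ _ _ k) // => [[<-] //|l lk].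
by rewrite kE k0max //; lia.
Qed.

(** The first maximum of the partial sums has the form [k.+1]: the maximum is positive, the empty
    sum is 0. *)
Lemma Yf_path r m g (i : 'I_r) :
  0 < Yphi i (path_monomial r m g) ->
  exists k, [/\ (k < m)%N,
    (forall l, (l <= k)%N -> partial_zeta g i l < partial_zeta g i k.+1),
    (forall l, (l <= m)%N -> partial_zeta g i l <= partial_zeta g i k.+1) &
    Yf i (path_monomial r m g) =
      Some (path_monomial r m g - Avar r k%:Z i.+1)].
Proof.
have [k0 k0m k0max] := partial_zeta_max g i m.
move=> phi0; have := phi0; rewrite (Yphi_path k0m k0max) => mk0.
pose P k := (k <= m)%N && (partial_zeta g i k == partial_zeta g i k0).
have exP : exists k, P k by exists k0; rewrite /P k0m eqxx.
case: (ex_minnP exP) => -[|k] /andP[km /eqP kE] kmin.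
  by move: mk0; rewrite -kE /partial_zeta big_geq // ltxx.
exists k; split=> // [l lk|l lm|].
- rewrite kE lt_neqAle k0max ?andbT; last by lia.
  apply/eqP => lE; have := kmin l; rewrite /P lE eqxx andbT => lP.
  by have := lP _; lia.
- by rewrite kE k0max.
rewrite /Yf phi0 /Ynf (Yphi_path k0m k0max); congr (Some (_ - Avar _ _ _)).
apply: zmin_eq => /=.
  rewrite Ypsum_path -kE; congr partial_zeta.
  by rewrite /clamp; case: ifP; lia.
move=> n; rewrite Ypsum_path => nE; have := kmin (clamp m n).
rewrite /P nE eqxx andbT /clamp; case: ifP => n0 lP.
  by have := lP isT; lia.
by have := lP (geq_minl _ _); lia.
Qed.

Lemma Yf_path_None r m g (i : 'I_r) :
  Yf i (path_monomial r m g) = None -> Yphi i (path_monomial r m g) <= 0.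
Proof. by rewrite /Yf; case: ltP. Qed.

(** * Changing one value of a height function *)

Definition add_at (g : nat -> nat -> int) (t j : nat) (c : int) : nat -> nat -> int :=
  fun t' j' => if (t' == t) && (j' == j) then g t' j' + c else g t' j'.

Lemma zeta_add_at g t i c s x :
  zeta (add_at g t.+1 i.+1 c) s x =
    zeta g s x + c * (((s == t) && (x == i))%:Z + ((s == t.+1) && (x == i))%:Z
                      - ((s == t.+1) && (x.+1 == i))%:Z - ((s == t) && (x == i.+1))%:Z).
Proof.
rewrite /zeta /add_at !eqSS.
case: (eqVneq s t) => st; case: (eqVneq s t.+1) => st'; try (by lia);
  case: (eqVneq x i) => xi; case: (eqVneq x i.+1) => xi';
  case: (eqVneq x.+1 i) => xi'' /=; lia.
Qed.

Lemma coeff_Yvar r (s s' : int) (x : 'I_r) j :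
  coeff (s, x) (Yvar r s' j) = ((s == s') && (x.+1 == j))%:Z.
Proof.
rewrite /Yvar raddf_sum /=.
transitivity (\sum_(i < r | i == x) ((i.+1 == j) && (s == s'))%:Z).
  rewrite big_mkcond [RHS]big_mkcond; apply: eq_bigr => i _.
  rewrite coeffU mul1r xpair_eqE [s' == s]eq_sym.
  case: (eqVneq i x) => [->|ix]; last by rewrite andbF; case: ifP.
  by rewrite andbT; case: (s == s'); case: (_ == j).
by rewrite big_pred1_eq andbC.
Qed.

(** The value at [t.+1], [i.+1] enters the exponents of rows [t] and [t.+1] only, with the signs of
    the factors of [Avar]; [t.+1 < m] ensures that both rows occur in the monomial. *)
Lemma path_monomial_add_at r m g t (i : 'I_r) c :
  (t.+1 < m)%N ->
  path_monomial r m (add_at g t.+1 i.+1 c) =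
    path_monomial r m g + Avar r t%:Z i.+1 *~ c.
Proof.
move=> tm; apply/eqP/freeg_eqP => -[s x]; rewrite coeffD raddfMz /=.
rewrite /Avar !coeffB !coeffD !coeff_Yvar /=.
case: s => s; last first.
  rewrite !coeff_path_monomial !big1 ?add0r //.
  by rewrite (_ : Negz s == t%:Z + 1 = false) ?mul0rz //; lia.
rewrite !coeff_path_monomial_nat zeta_add_at !eqSS.
rewrite (_ : (s%:Z == t%:Z + 1) = (s == t.+1)) ?eqz_nat; last by lia.
rewrite -mulrzl intz.
case: (eqVneq s t) => st; case: (eqVneq s t.+1) => st'; try (by lia);
  case: (eqVneq (x : nat) i) => xi; case: (eqVneq (x : nat) i.+1) => xi';
  case: (eqVneq x.+1 i) => xi'' /=; case: ltnP => sm; lia.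
Qed.

(** The negative exponent forces [e1], [e3], [e4] and [e5], and the sign of the preceding one then
    forces [e2]. Together they are the room upwards in the constraints on the raised value. *)
Lemma height_fn_raise m m' D g k i :
  height_fn m m' D g -> (k.+1 < m)%N -> zeta g k.+1 i < 0 -> 0 <= zeta g k i ->
  height_fn m m' D (add_at g k.+1 i.+1 1).
Proof.
move=> gP km zk1 zk; have kmW := ltnW km.
have st t (tm : (t <= m)%N) := hf_row gP tm.
have c1 := hf_col gP _ km; have c0 := hf_col gP _ kmW.
have d1 := hf_diag gP _ km; have d0 := hf_diag gP _ kmW.
move: zk1 zk; rewrite /zeta => zk1 zk.
have s0 := st _ (ltnW kmW); have s1 := st _ kmW; have s2 := st _ km.
have e1 : g k.+1 i.+1 = g k.+2 i.+1.
  by move: (c1 i.+1) (c1 i) (d1 i) (d1 i.+1) (s1 i.+1) (s2 i); lia.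
have e2 : g k i.+1 = g k.+1 i.+1 + 1.
  by move: (c0 i.+1) (c1 i.+1) (c1 i) (d1 i) (d1 i.+1) (s1 i.+1) (s2 i) (s1 i)
    (d0 i.+1) (d0 i) (c0 i.+2) (s0 i.+1); lia.
have e3 : g k.+2 i = g k.+2 i.+1 + 1.
  by move: (c1 i.+1) (c1 i) (d1 i) (d1 i.+1) (s1 i.+1) (s2 i); lia.
have e4 : g k.+1 i = g k.+1 i.+1 + 1.
  by move: (c1 i.+1) (c1 i) (d1 i) (d1 i.+1) (s1 i.+1) (s2 i) (s1 i); lia.
have e5 : g k.+1 i.+1 = g k.+1 i.+2.
  by move: (c1 i.+1) (c1 i) (d1 i) (d1 i.+1) (s1 i.+1) (s2 i) (s1 i); lia.
split.
- by move=> j; rewrite /add_at /= (hf_top gP).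
- by move=> j; rewrite /add_at (gtn_eqF km) /= (hf_bot gP).
- move=> t tm j; have := st t tm j; rewrite /add_at.
  case: (eqVneq t k.+1) => [->|//] /=; rewrite eqSS.
  case: (eqVneq j i) => [->|ji] /=.
    by rewrite (ltn_eqF (ltnSn i)); lia.
  by case: eqP => [->|]; lia.
- move=> t j tm; have := hf_col gP j tm; rewrite /add_at eqSS.
  case: (eqVneq t k) => [->|tk] /=.
    by rewrite (ltn_eqF (ltnSn k)) /=; case: eqP => [->|]; lia.
  by case: (eqVneq t k.+1) => [->|] //=; case: eqP => [->|]; lia.
move=> t j tm; have := hf_diag gP j tm; rewrite /add_at !eqSS.
case: (eqVneq t k) => [->|tk] /=.
  by rewrite (ltn_eqF (ltnSn k)) /=; case: eqP => [->|]; lia.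
by case: (eqVneq t k.+1) => [->|] //=; case: eqP => [->|]; lia.
Qed.

Lemma height_fn_lower m m' D g k i :
  height_fn m m' D g -> (k < m)%N -> 0 < zeta g k i ->
  ((k.+1 < m)%N -> zeta g k.+1 i <= 0) ->
  (k.+1 < m)%N /\ height_fn m m' D (add_at g k.+1 i.+1 (-1)).
Proof.
move=> gP kmW zk zk1.
have st t (tm : (t <= m)%N) := hf_row gP tm.
have c0 := hf_col gP _ kmW; have d0 := hf_diag gP _ kmW.
move: zk zk1; rewrite /zeta => zk zk1.
have s0 := st _ (ltnW kmW); have s1 := st _ kmW.
have km : (k.+1 < m)%N.
  (* If [k.+1 = m], a positive exponent needs equal initial heights at [i] and [i.+1]. Both are then
     0, and by the diagonal inequality so is [g k i.+1], a contradiction. *)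
  rewrite ltn_neqAle kmW andbT; apply/eqP => km.
  have bot j : g k.+1 j = profile D m' m' j by rewrite km (hf_bot gP).
  move: (d0 i) (d0 i.+1) (c0 i.+1) (s0 i.+1) zk; rewrite !bot.
  have := height_fn_ge0 i.+2 gP (ltnW kmW).
  by rewrite /profile; lia.
have {}zk1 := zk1 km.
have c1 := hf_col gP _ km; have d1 := hf_diag gP _ km; have s2 := st _ km.
have e1 : g k.+1 i = g k.+1 i.+1.
  by move: (c0 i.+1) (c0 i) (d0 i) (d0 i.+1) (s0 i.+1) (s1 i); lia.
have e2 : g k i.+1 = g k i.+2 + 1.
  by move: (c0 i.+1) (c0 i) (d0 i) (d0 i.+1) (s0 i.+1) (s1 i); lia.
have e3 : g k i.+1 = g k.+1 i.+1.
  by move: (c0 i.+1) (c0 i) (d0 i) (d0 i.+1) (s0 i.+1) (s1 i); lia.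
have e4 : g k.+1 i.+1 = g k.+1 i.+2 + 1.
  by move: (c0 i.+1) (c0 i) (d0 i) (d0 i.+1) (s0 i.+1) (s1 i) (s1 i.+1) (c0 i.+2); lia.
have e5 : g k.+1 i.+1 = g k.+2 i.+1 + 1.
  by move: (c1 i.+1) (c1 i) (d1 i) (d1 i.+1) (s1 i.+1) (s2 i); lia.
split=> //; split.
- by move=> j; rewrite /add_at /= (hf_top gP).
- by move=> j; rewrite /add_at (gtn_eqF km) /= (hf_bot gP).
- move=> t tm j; have := st t tm j; rewrite /add_at.
  case: (eqVneq t k.+1) => [->|//] /=; rewrite eqSS.
  case: (eqVneq j i) => [->|ji] /=.
    by rewrite (ltn_eqF (ltnSn i)); lia.
  by case: eqP => [->|]; lia.
- move=> t j tm; have := hf_col gP j tm; rewrite /add_at eqSS.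
  case: (eqVneq t k) => [->|tk] /=.
    by rewrite (ltn_eqF (ltnSn k)) /=; case: eqP => [->|]; lia.
  by case: (eqVneq t k.+1) => [->|] //=; case: eqP => [->|]; lia.
move=> t j tm; have := hf_diag gP j tm; rewrite /add_at !eqSS.
case: (eqVneq t k) => [->|tk] /=.
  by rewrite (ltn_eqF (ltnSn k)) /=; case: eqP => [->|]; lia.
by case: (eqVneq t k.+1) => [->|] //=; case: eqP => [->|]; lia.
Qed.

(** * Demazure crystals *)

(** Prefixing the letter [i.+1] of the cycle [s.+1] frees the value [g s.+1 i.+1], that is, replaces
    [p = i.+2] by [p = i.+1]. *)
Definition frozen (D m' s p : nat) (g : nat -> nat -> int) : Prop :=
  (forall t j, (t <= s)%N -> g t j = profile D m' t j) /\
  (forall j, (j < p)%N -> g s.+1 j = profile D m' s.+1 j).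

Lemma profile_shift D m' t j : profile D m' t.+1 j = profile D m' t j.+1.
Proof. by rewrite /profile addSn addnS. Qed.

(** Equality holds in row 0, and [hf_diag] carries the bound to the next row because profiles are
    shifts of each other. *)
Lemma profile_le m m' D g t j :
  height_fn m m' D g -> (t <= m)%N -> profile D m' t j <= g t j.
Proof.
move=> gP; elim: t j => [|t IHt] j tm; first by rewrite (hf_top gP).
rewrite profile_shift; exact: le_trans (IHt _ (ltnW tm)) (hf_diag gP _ tm).
Qed.

Lemma frozen_zeta m m' D g s i k :
  height_fn m m' D g -> frozen D m' s i.+1 g -> (k <= s)%N -> (k < m)%N ->
  0 <= zeta g k i.
Proof.
move=> gP [fr fr'] ks km; rewrite /zeta (fr k) // (fr k) //.
have -> : g k.+1 i = profile D m' k i.+1.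
  rewrite -profile_shift; move: ks; rewrite leq_eqVlt => /orP[/eqP ->|ks].
    by rewrite fr'.
  by rewrite fr.
by have := profile_le i.+1 gP km; rewrite profile_shift; lia.
Qed.

Lemma frozen_raise D m' s i t g c :
  frozen D m' s i.+1 g -> (s < t)%N -> frozen D m' s i.+1 (add_at g t i.+1 c).
Proof.
case=> fr fr' st; split=> [t' j t's|j ji]; rewrite /add_at.
  by rewrite (_ : t' == t = false) ?fr //; lia.
by rewrite (_ : j == i.+1 = false) ?andbF ?fr' //; lia.
Qed.

Lemma frozen_lower m m' D s p t j g :
  height_fn m m' D (add_at g t j (-1)) -> (s < m)%N ->
  frozen D m' s p g -> frozen D m' s p (add_at g t j (-1)).
Proof.
move=> gP sm [fr fr']; split=> [t' j' t's|j' j'p].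
  have := profile_le j' gP (leq_trans t's (ltnW sm)).
  by rewrite /add_at fr //; case: ifP => //; lia.
by have := profile_le j' gP sm; rewrite /add_at fr' //; case: ifP => //; lia.
Qed.

(** The exponents before row [s] vanish and that of row [s] is the excess of [g s.+1 i.+1]; this
    excess is thus a partial sum, bounded by [Yphi]. *)
Lemma frozenS m m' D r s (i : 'I_r) g :
  height_fn m m' D g -> (s < m)%N -> frozen D m' s i.+1 g ->
  Yphi i (path_monomial r m g) <= 0 -> frozen D m' s i.+2 g.
Proof.
move=> gP sm /[dup] fri [fr fr'] phi0; split=> // j.
rewrite ltnS leq_eqVlt => /orP[/eqP ->|]; last exact: fr'.
apply/le_anti; rewrite (profile_le _ gP) // andbT -subr_le0.
have := Yphi_path_ge g i sm; rewrite /partial_zeta big_nat_recr //=.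
rewrite big_nat big1 ?add0r => [|t ts].
  move/le_trans/(_ phi0); apply: le_trans; rewrite /zeta.
  by rewrite (fr' i) // !(fr s) // !profile_shift; lia.
have ts' : (t <= s)%N by apply: ltnW.
by rewrite /zeta !fr // !profile_shift; lia.
Qed.

(** As [m' + D <= r.+1], the profile of row [s.+1] is 0 at [r - s]; decreasing nonnegative heights
    agree with it from there on. *)
Lemma frozen_next m m' D r s g :
  (m' + D <= r.+1)%N -> (s.+1 < m')%N -> (s.+1 < m)%N ->
  height_fn m m' D g -> frozen D m' s (r - s).+1 g <-> frozen D m' s.+1 1 g.
Proof.
move=> m'D sm' sm gP.
have left j : (j < 1)%N -> g s.+2 j = profile D m' s.+2 j.
  by case: j => // _; rewrite (height_fn_left gP) // /profile; lia.
split=> [[fr fr']|[fr _]]; last first.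
  by split=> [t j ts|j _]; apply: fr => //; apply: leqW.
split=> // t j; rewrite leq_eqVlt => /orP[/eqP ->|]; last exact: fr.
have [jr|jr] := ltnP j (r - s).+1; first exact: fr'.
have g0 : g s.+1 (r - s)%N = 0 by rewrite fr' // /profile; lia.
suff gj k : g s.+1 (r - s + k)%N = 0.
  by rewrite -(subnKC (ltnW jr)) gj /profile; lia.
elim: k => [|k IHk]; first by rewrite addn0.
rewrite addnS; have := hf_row gP (ltnW sm) (r - s + k)%N.
by have := height_fn_ge0 (r - s + k).+1 gP (ltnW sm); rewrite IHk; lia.
Qed.

Lemma frozen0 m m' D g :
  (0 < m)%N -> (0 < m')%N -> height_fn m m' D g -> frozen D m' 0 1 g.
Proof.
move=> m0 m'0 gP; split=> [t j|[]// _].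
  by rewrite leqn0 => /eqP ->; rewrite (hf_top gP).
by rewrite (height_fn_left gP) // /profile; lia.
Qed.

(** The particles rest until only [m'] cycles remain to be read, then all advance by one in each of
    them. *)
Definition lowest_path (D m' t j : nat) : int := profile D m' (minn t m') j.

(** Row [m'] is frozen until it reaches 0 at [D]; the rows after it are squeezed by [hf_col] between
    rows [m'] and [m], which coincide. *)
Lemma frozen_lowest m m' D g :
  (0 < m' <= m)%N -> height_fn m m' D g -> frozen D m' m'.-1 D.+1 g ->
  forall t j, (t <= m)%N -> g t j = lowest_path D m' t j.
Proof.
case: m' => // m' /= m'm gP [fr fr'].
have gm' j : g m'.+1 j = profile D m'.+1 m'.+1 j.
  have [jD|jD] := ltnP j D.+1; first exact: fr'.
  suff gj k : g m'.+1 (D + k)%N = 0.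
    by rewrite -(subnKC (ltnW jD)) gj /profile; lia.
  elim: k => [|k IHk]; first by rewrite addn0 fr' // /profile; lia.
  rewrite addnS; have := hf_row gP m'm (D + k)%N.
  by have := height_fn_ge0 (D + k).+1 gP m'm; rewrite IHk; lia.
move=> t j tm; rewrite /lowest_path; have [tm'|tm'] := leqP t m'.
  by rewrite fr // (minn_idPl _) // ltnW.
rewrite (minn_idPr _) //; apply/le_anti/andP; split.
  suff gk k : (m'.+1 + k <= m)%N -> g (m'.+1 + k)%N j <= profile D m'.+1 m'.+1 j.
    by have := gk (t - m'.+1)%N; rewrite subnKC //; apply.
  elim: k => [|k IHk] km; first by rewrite addn0 gm'.
  rewrite addnS in km *.
  by have := hf_col gP j km; have := IHk (ltnW km); lia.
suff gk k : (k <= m)%N -> profile D m'.+1 m'.+1 j <= g (m - k)%N j.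
  by have := gk (m - t)%N; rewrite subKn // leq_subr => /(_ isT).
elim: k => [|k IHk] km; first by rewrite subn0 (hf_bot gP).
have := @hf_col _ _ _ _ gP (m - k.+1)%N j; rewrite subnSK //.
by move: (IHk (ltnW km)); lia.
Qed.

Lemma height_fn_lowest m m' D :
  (0 < m' <= m)%N -> height_fn m m' D (lowest_path D m').
Proof.
move=> m'm; rewrite /lowest_path; split.
- by move=> j; rewrite min0n.
- by move=> j; rewrite (minn_idPr _) //; lia.
- by move=> t _; apply: stairs_profile.
- by move=> t j _; rewrite /profile; lia.
- by move=> t j _; rewrite /profile; lia.
Qed.

(** For [s < m'] successive rows are shifts and [zeta] cancels; for [s >= m'] they coincide, and the
    only corner, at [d.+1], gives exponent -1. *)
Lemma path_monomial_lowest r m m' d g :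
  (0 < m' <= m)%N -> (forall t j, (t <= m)%N -> g t j = lowest_path d.+1 m' t j) ->
  path_monomial r m g = Ylowest r m' m d.+1.
Proof.
move=> m'm gE; apply/eqP/freeg_eqP => -[s x].
rewrite /Ylowest coeffN [in RHS]raddf_sum /=.
rewrite (eq_bigr (fun t : nat => ((s == t%:Z) && (x.+1 == d.+1))%:Z)); last first.
  by move=> t _; rewrite coeff_Yvar.
case: s => s; last first.
  rewrite coeff_path_monomial !big1 ?oppr0 //.
rewrite coeff_path_monomial_nat.
rewrite (eq_bigr (fun i => if i == s then (x.+1 == d.+1)%:Z else 0)); last first.
  by move=> i _; rewrite eqz_nat eq_sym; case: eqP.
rewrite -big_mkcond /= big_nat1_eq.
case: (ltnP s m) => sm; last first.
  by rewrite andbF oppr0.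
rewrite /zeta !gE ?(ltnW sm) //.
rewrite /lowest_path /profile andbT; case: (leqP m' s) => m's.
  by case: (eqVneq x.+1 d.+1) => xd; lia.
by lia.
Qed.

Lemma frozen_of_lowest m m' D :
  (0 < m' <= m)%N -> frozen D m' m'.-1 D.+1 (lowest_path D m').
Proof.
case: m' => // m' _; split=> [t j tm|j _]; rewrite /lowest_path.
  by rewrite (minn_idPl _) // ltnW.
by rewrite minnn.
Qed.

(** Each [Yphi i <= 0] freezes one more value by [frozenS]; running through the first [m'] cycles
    leaves only the lowest path. *)
Lemma lowest_of_phi r m m' D g :
  (0 < m' <= m)%N -> (m <= r)%N -> (m' + D <= r.+1)%N -> height_fn m m' D g ->
  (forall i : 'I_r, Yphi i (path_monomial r m g) <= 0) ->
  forall t j, (t <= m)%N -> g t j = lowest_path D m' t j.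
Proof.
move=> m'm mr m'D gP phi0; apply: frozen_lowest => //.
have row s p : (s < m')%N -> frozen D m' s 1 g -> (p <= r)%N -> frozen D m' s p.+1 g.
  move=> sm' fr1; elim: p => // p IHp pr.
  apply: (@frozenS m m' D r s (Ordinal pr)) => //; first by lia.
  exact: IHp (ltnW pr).
have fr1 s : (s < m')%N -> frozen D m' s 1 g.
  elim: s => [|s IHs] sm'; first by apply: (@frozen0 m) => //; lia.
  apply/(@frozen_next m m' D r) => //; first by lia.
  by apply: row; [lia | exact: IHs (ltnW sm') | exact: leq_subr].
by apply: row; [lia | apply: fr1; lia | lia].
Qed.

(** * The Demazure recursion on height functions *)

Lemma ce_powS r T (c : crystal r T) i k b :
  ce_pow c i k.+1 b = obind (ce c i) (ce_pow c i k b).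
Proof. by []. Qed.

Definition path_size (r m : nat) (g : nat -> nat -> int) : nat :=
  absz (\sum_(t < m) \sum_(j < r.+1) g t j).

Lemma path_size_lower r m m' D g k (i : 'I_r) :
  height_fn m m' D (add_at g k.+1 i.+1 (-1)) -> (k.+1 < m)%N ->
  (path_size r m (add_at g k.+1 i.+1 (-1)) < path_size r m g)%N.
Proof.
move=> gP km; rewrite /path_size; set S := \sum_(t < m) _.
have S0 : 0 <= S.
  apply: sumr_ge0 => t _; apply: sumr_ge0 => j _.
  exact: height_fn_ge0 gP (ltnW (ltn_ord t)).
suff : \sum_(t < m) \sum_(j < r.+1) g t j = S + 1 by lia.
have ir : (i.+1 < r.+1)%N by rewrite ltnS.
rewrite /S (bigD1 (Ordinal km)) //= [in RHS](bigD1 (Ordinal km)) //=.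
rewrite (bigD1 (Ordinal ir)) //= [in RHS](bigD1 (Ordinal ir)) //=.
rewrite {1}/add_at !eqxx /=.
rewrite [\sum_(_ < r.+1 | _) add_at _ _ _ _ _ _](eq_bigr (fun j : 'I_r.+1 => g k.+1 j)).
  rewrite [\sum_(_ < m | _) \sum_(_ < r.+1) add_at _ _ _ _ _ _](eq_bigr
    (fun t : 'I_m => \sum_(j < r.+1) g t j));
    first by move: (\sum_(_ < r.+1 | _) _) (\sum_(_ < m | _) _) => X Y; lia.
  move=> t tk; apply: eq_bigr => j _; rewrite /add_at.
  by rewrite (_ : (t == k.+1 :> nat) = false) //; apply: contra_neqF tk => /eqP tk; apply: val_inj.
move=> j ji; rewrite /add_at eqxx.
by rewrite (_ : (j == i.+1 :> nat) = false) //; apply: contra_neqF ji => /eqP ji; apply: val_inj.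
Qed.

(* Being a crystal base is used only through the mutual inverseness of the e_i
   and f_i. *)
Record crystal_model r (B : finType) (cB : crystal r B) (v : B)
    (Z : monomial r) (mu : B -> monomial r) : Prop := CrystalModel {
  cm_emb : crystal_embedding cB (Ycrystal r) mu;
  cm_low : mu v = Z;
  cm_ef : forall i b b', cf cB i b = Some b' <-> ce cB i b' = Some b }.

Definition frozen_image r (B : finType) (mu : B -> monomial r) (m m' D s p : nat)
    (x : B) : Prop :=
  exists g, [/\ height_fn m m' D g, frozen D m' s p g & mu x = path_monomial r m g].

Lemma frozen_image_e r (B : finType) (cB : crystal r B) v Z mu m m' D s (i : 'I_r) x y :
  crystal_model cB v Z mu -> (s < m)%N ->
  frozen_image mu m m' D s i.+1 x -> ce cB i x = Some y ->
  frozen_image mu m m' D s i.+1 y.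
Proof.
move=> cm sm [g [gP fr xg]] xy.
have := emb_e (cm_emb cm) i x; rewrite xy xg /= => /Ye_path_inv[k [km zk zk1 yg]].
have sk : (s < k)%N.
  by rewrite ltnNge; apply: contraTN zk => ks; rewrite -leNgt (frozen_zeta gP fr).
case: k => // k in km zk zk1 yg sk.
exists (add_at g k.+1 i.+1 1); split.
- by apply: height_fn_raise => //; apply: zk1.
- exact: frozen_raise.
by rewrite yg path_monomial_add_at // mulr1z -addn1 PoszD addrK.
Qed.

Lemma frozen_Yf r m m' D s p (i : 'I_r) g :
  (s < m)%N -> height_fn m m' D g -> frozen D m' s p g -> 0 < Yphi i (path_monomial r m g) ->
  exists g', [/\ height_fn m m' D g', frozen D m' s p g',
    Yf i (path_monomial r m g) = Some (path_monomial r m g'),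
    Ye i (path_monomial r m g') = Some (path_monomial r m g) &
    (path_size r m g' < path_size r m g)%N].
Proof.
move=> sm gP fr /Yf_path[k [km klt kle YfE]].
have zk : 0 < zeta g k i.
  by have := klt k (leqnn k); rewrite /partial_zeta big_nat_recr //= ltrDl.
have zk1 : (k.+1 < m)%N -> zeta g k.+1 i <= 0.
  by move=> k1m; have := kle k.+2 k1m; rewrite /partial_zeta big_nat_recr //= gerDl.
have [k1m g'P] := height_fn_lower gP km zk zk1.
set g' := add_at _ _ _ _ in g'P.
have g'E : path_monomial r m g' = path_monomial r m g - Avar r k%:Z i.+1.
  by rewrite path_monomial_add_at // mulrNz mulr1z.
exists g'; split=> //.
- exact: frozen_lower g'P sm fr.
- by rewrite YfE g'E.
(* The partial sum at [k.+1] drops by 1 and all later ones by 2, so the former first maximum becomes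
   the last one and the raising operator reverts the step. *)
- have Q' l : partial_zeta g' i l = partial_zeta g i l - (k < l)%N%:Z - (k.+1 < l)%N%:Z.
    rewrite /partial_zeta; elim: l => [|l IHl]; first by rewrite !big_geq.
    rewrite !big_nat_recr //= IHl zeta_add_at !eqxx !andbT.
    rewrite (gtn_eqF (ltnSn i)) (ltn_eqF (ltnSn i)) !andbF.
    move: (\sum_(0 <= s0 < l) _) (zeta g l i) => X Y.
    by case: (eqVneq l k) => lk; case: (eqVneq l k.+1) => lk1 /=; lia.
  rewrite (@Ye_path _ _ _ _ k.+1) //.
  + by rewrite g'E (_ : k.+1%:Z - 1 = k%:Z) ?subrK //; lia.
  + move=> l lk; rewrite !Q'; have [lk'|lk'] := leqP l k.
      by have := klt l lk'; lia.
    by rewrite (_ : l = k.+1) //; lia.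
  by move=> l /andP[kl lm]; rewrite !Q'; have := kle l lm; lia.
exact: path_size_lower g'P k1m.
Qed.

(** Raising keeps the values frozen up to [i]. Conversely, [cf] is applied until it gives 0, which
    happens because [path_size] drops; then [frozenS] freezes one more value and the element lies in
    [B1]. *)
Lemma demazure_step r (B : finType) (cB : crystal r B) v Z mu m m' D s (i : 'I_r)
    (B1 B2 : {set B}) :
  crystal_model cB v Z mu -> (s < m)%N ->
  (forall x, x \in B1 <-> frozen_image mu m m' D s i.+2 x) ->
  (forall x, x \in B2 <-> exists (k : nat) (b : B),
        [/\ b \in B1, cf cB i b = None & ce_pow cB i k b = Some x]) ->
  forall x, x \in B2 <-> frozen_image mu m m' D s i.+1 x.
Proof.
move=> cm sm B1E B2E x; rewrite B2E; split.
  case=> k [b [/B1E[g [gP [fr fr'] bg]] _]].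
  have b_im : frozen_image mu m m' D s i.+1 b.
    by exists g; split=> //; split=> // j ji; apply: fr'; apply: leqW.
  elim: k x => [|k IHk] x; first by case=> <-.
  rewrite ce_powS; case: (ce_pow cB i k b) IHk => //= y IHk yx.
  exact: frozen_image_e cm sm (IHk _ erefl) yx.
case=> g [gP fr xg].
have [N] := ubnP (path_size r m g); elim: N g x gP fr xg => // N IHN g x gP fr xg gN.
have := emb_f (cm_emb cm) i x; rewrite xg /=; case fx: (cf cB i x) => [y|] /= YfE.
  have phi0 : 0 < Yphi i (path_monomial r m g) by move: YfE; rewrite /Yf; case: ifP.
  have [g' [g'P fr' YfE' _ size_g']] := frozen_Yf sm gP fr phi0.
  have yg' : mu y = path_monomial r m g' by move: YfE'; rewrite YfE => -[].
  have [|k [b [bB1 fb eb]]] := IHN g' y g'P fr' yg'.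
    exact: leq_trans size_g' gN.
  exists k.+1, b; split=> //; rewrite ce_powS eb /=.
  by apply/(cm_ef cm).
exists 0%N, x; split=> //; apply/B1E; exists g; split=> //.
exact: frozenS fr (Yf_path_None YfE).
Qed.

(** Lowering operators lead down to the lowest path, whose monomial is the image of [v]; the way
    back up stays in the image because [mu] commutes with the raising operators. *)
Lemma path_monomial_in_image r (B : finType) (cB : crystal r B) v mu m m' d g :
  crystal_model cB v (Ylowest r m' m d.+1) mu ->
  (0 < m' <= m)%N -> (m <= r)%N -> (m' + d.+1 <= r.+1)%N ->
  height_fn m m' d.+1 g -> exists x, mu x = path_monomial r m g.
Proof.
move=> cm m'm mr m'D gP.
have sm : (0 < m)%N by lia.
have m'0 : (0 < m')%N by lia.
have [N] := ubnP (path_size r m g); elim: N g gP => // N IHN g gP gN.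
have [phi0|/existsNP[i phi0]] :=
    pselect (forall i : 'I_r, Yphi i (path_monomial r m g) <= 0).
  exists v; rewrite (cm_low cm); apply/esym/path_monomial_lowest => //.
  exact: (@lowest_of_phi r).
have {}phi0 : 0 < Yphi i (path_monomial r m g) by rewrite ltNge; apply/negP.
have [g' [g'P _ _ YeE size_g']] := frozen_Yf sm gP (frozen0 sm m'0 gP) phi0.
have [|y yg'] := IHN g' g'P; first exact: leq_trans size_g' gN.
have := emb_e (cm_emb cm) i y; rewrite yg' /= YeE.
by case: (ce cB i y) => //= x [->]; exists x.
Qed.

(** * The word and its Weyl group elements *)

Lemma val_srefl r (i : 'I_r) (x : 'I_r.+1) :
  srefl r i.+1 x = (if x == i :> nat then i.+1
                    else if x == i.+1 :> nat then i : nat else x) :> nat.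
Proof.
have i_lt : (i < r.+1)%N by rewrite ltnS ltnW.
have hi_lt : (i.+1 < r.+1)%N by rewrite ltnS.
rewrite /srefl /= permE /= -!val_eqE /= !inordK //.
by case: eqP => _; rewrite ?inordK //; case: eqP => _; rewrite ?inordK.
Qed.

Lemma weyl_wordE r i w x :
  weyl_word r (i :: w) x = srefl r i (weyl_word r w x).
Proof. by rewrite /= /weyl_mul permM. Qed.

Lemma weyl_word_cat r w1 w2 x :
  weyl_word r (w1 ++ w2) x = weyl_word r w1 (weyl_word r w2 x).
Proof. by elim: w1 => [|i w1 IHw] /=; rewrite ?perm1 // /weyl_mul !permM IHw. Qed.

Lemma weyl_mul_word r i w :
  weyl_mul (srefl r i) (weyl_word r (i :: w)) = weyl_word r w.
Proof. by rewrite /= /weyl_mul -mulgA tperm2 mulg1. Qed.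

Lemma weyl_word_fix r n w (x : 'I_r.+1) :
  (n <= r)%N -> all (fun i => 0 < i <= n)%N w -> (n < x)%N -> weyl_word r w x = x.
Proof.
move=> nr w_le nx; elim: w w_le => [|i w IHw]; first by rewrite /= perm1.
case/andP=> i_le /IHw wx; rewrite weyl_wordE wx; apply: val_inj.
case: i i_le => // i /= i_le; have ir : (i < r)%N by lia.
rewrite (val_srefl (Ordinal ir)) /=; do 2?[case: eqP => //; try lia].
Qed.

Lemma weyl_word_iota r p n (x : 'I_r.+1) :
  (p + n <= r)%N ->
  weyl_word r (iota p.+1 n) x =
    (if (x < p)%N || (p + n < x)%N then x : nat
     else if (x < p + n)%N then x.+1 else p) :> nat.
Proof.
elim: n p x => [|n IHn] p x pn; first by rewrite /= perm1; case: ifP => //; case: ifP; lia.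
have ir : (p < r)%N by lia.
rewrite [iota _ _]/= weyl_wordE (val_srefl (Ordinal ir)) /= IHn; last by lia.
by repeat case: ifP; lia.
Qed.

(** Exchanging the values [i] and [i.+1] reverses only the pair [x], [y], which was in order: all
    inversions survive and one is added. *)
Lemma perm_length_lt r (i : 'I_r) (u : 'S_r.+1) (x y : 'I_r.+1) :
  u x = i :> nat -> u y = i.+1 :> nat -> (x < y)%N ->
  (perm_length u < perm_length (weyl_mul (srefl r i.+1) u))%N.
Proof.
move=> ux uy xy; apply: proper_card; apply/properP; split.
  apply/fintype.subsetP=> -[a b]; rewrite !inE /= => /andP[ab uba]; rewrite ab /=.
  rewrite /weyl_mul !permM !val_srefl.
  have ux' c : u c = i :> nat -> c = x.
    by move=> uc; apply: (@perm_inj _ u); apply: val_inj; rewrite /= uc ux.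
  have uy' c : u c = i.+1 :> nat -> c = y.
    by move=> uc; apply: (@perm_inj _ u); apply: val_inj; rewrite /= uc uy.
  case: (eqVneq (u a : nat) i.+1) => [/uy' ay|na].
    case: (eqVneq (u b : nat) i) => [/ux' bx|nb]; first by move: ab; rewrite ay bx; lia.
    by repeat case: ifP; move: uba; rewrite ?ay ?uy; lia.
  by repeat case: ifP; lia.
exists (x, y); rewrite !inE /= xy /=; last by rewrite ux uy; lia.
rewrite /weyl_mul !permM !val_srefl ux uy eqxx (gtn_eqF (ltnSn i)) eqxx.
exact: ltnSn.
Qed.

(* With u the shorter product: u maps i+1+n, fixed by w, to i+1, and the preimage
   of i under u is smaller because w permutes the positions below i+1+n. *)
Lemma reduced_word_step r (i : 'I_r) n w :
  (i.+1 + n <= r)%N -> all (fun j => 0 < j < i.+1 + n)%N w ->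
  (perm_length (weyl_word r (iota i.+2 n ++ w)) <
   perm_length (weyl_word r (i.+1 :: iota i.+2 n ++ w)))%N.
Proof.
move=> inr w_lt; set u := weyl_word r (_ ++ w).
have w_fix (z : 'I_r.+1) : (i.+1 + n <= z)%N -> weyl_word r w z = z.
  move=> inz; apply: (@weyl_word_fix r (i + n)) => //; lia.
have yr : (i.+1 + n < r.+1)%N by [].
have xr : (i < r.+1)%N by rewrite ltnS ltnW.
set x := (weyl_word r w)^-1%g (Ordinal xr).
have wx : weyl_word r w x = Ordinal xr by rewrite permKV.
apply: (@perm_length_lt _ _ _ x (Ordinal yr)).
- by rewrite weyl_word_cat wx weyl_word_iota //= ltnSn.
- by rewrite weyl_word_cat w_fix // weyl_word_iota //= !ltnn; case: ifP; lia.
rewrite /= ltnNge; apply/negP => yx; move: wx; rewrite w_fix // => xE.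
by move: yx; rewrite xE /=; lia.
Qed.

(** * Splitting the word into cycles *)

Definition cycles (L : nat -> nat) (s n : nat) : seq nat :=
  flatten [seq iota 1 (L t) | t <- iota s n].

Lemma size_cycles r (L : nat -> nat) n :
  (forall t, (t < n)%N -> L t = r - t)%N -> size (cycles L 0 n) = cycle_start r n.
Proof.
elim: n => [|n IHn] Lr; first by rewrite /cycle_start big_geq.
rewrite /cycles -[in LHS](addn1 n) iotaD map_cat flatten_cat size_cat IHn; last first.
  by move=> t tn; apply: Lr; apply: leqW.
by rewrite /= cats0 size_iota Lr ?add0n // /cycle_start [RHS]big_nat_recr //= subSS.
Qed.

Lemma cycle_startS r s : (cycle_start r s.+1 = cycle_start r s + (r - s))%N.
Proof. by rewrite /cycle_start big_nat_recr //= subSS. Qed.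

Definition cycle_length (r m D t : nat) : nat := if (t.+1 < m)%N then (r - t)%N else D.

Lemma cycle_length_last r m D : cycle_length r m.+1 D m = D.
Proof. by rewrite /cycle_length ltnn. Qed.

Lemma wordE r m a : (0 < m)%N -> word r m a = cycles (cycle_length r m a) 0 m.
Proof.
case: m => // m _; rewrite /word /cycles.
have -> : iota 0 m.+1 = iota 0 m ++ [:: m] by rewrite -(addn1 m) iotaD.
rewrite map_cat flatten_cat.
rewrite /= cats0 cycle_length_last; congr (flatten _ ++ _).
apply/eq_in_map => t; rewrite mem_iota add0n /= => tm.
by rewrite /cycle_length ltnS tm.
Qed.

Lemma cycles_split (L : nat -> nat) m s : (s < m)%N ->
  cycles L 0 m = cycles L 0 s ++ iota 1 (L s) ++ cycles L s.+1 (m - s.+1).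
Proof.
move=> sm; rewrite /cycles -{1}(subnKC (ltnW sm)) iotaD map_cat flatten_cat add0n.
by rewrite -subnSK.
Qed.

Lemma letter_word r m a s j :
  (s < m)%N -> (j < cycle_length r m a s)%N ->
  letter (word r m a) (cycle_start r s + j).+1 = j.+1.
Proof.
move=> sm jL; rewrite wordE ?(leq_ltn_trans _ sm) // (cycles_split _ sm) /letter /=.
rewrite nth_cat (@size_cycles r); last by move=> t ts; rewrite /cycle_length ifT //; lia.
by rewrite ltnNge leq_addr /= addKn nth_cat size_iota jL nth_iota.
Qed.

Lemma size_word r m a :
  (0 < m)%N -> size (word r m a) = (cycle_start r m.-1 + a)%N.
Proof.
case: m => // m _; rewrite wordE // (cycles_split _ (ltnSn m)) !size_cat.
rewrite (@size_cycles r); last by move=> t ts; rewrite /cycle_length ifT.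
by rewrite subnn /= size_iota addn0 cycle_length_last.
Qed.

Lemma letter_position r m a m' k :
  (m' <= m)%N -> (0 < m')%N -> in_cycle r m' k -> (k <= size (word r m a))%N ->
  k = (cycle_start r m'.-1 + letter (word r m a) k)%N.
Proof.
move=> m'm m'0; rewrite /in_cycle => /andP[k_gt k_le] k_size.
case: k k_gt k_le k_size => // k k_gt k_le k_size.
rewrite -(subnKC (k_gt : (_ <= k)%N)) letter_word; try by lia.
case: m' m'0 m'm k_gt k_le => // m' _ m'm /= k_gt; rewrite cycle_startS => k_le.
rewrite /cycle_length; case: (ltnP m'.+1 m) => mm'; first by lia.
have mE : m = m'.+1 by lia.
by move: k_size; rewrite mE size_word //=; lia.
Qed.

Lemma take_word r m a m' D :
  (0 < m' <= m)%N -> (D <= cycle_length r m a m'.-1)%N ->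
  take (cycle_start r m'.-1 + D) (word r m a) = cycles (cycle_length r m' D) 0 m'.
Proof.
case: m' => // m' /= m'm DL; rewrite wordE; last by lia.
rewrite (cycles_split _ m'm) [RHS](cycles_split _ (ltnSn m')) subnn cats0.
have sz (M D' : nat) : (m' < M)%N -> size (cycles (cycle_length r M D') 0 m') = cycle_start r m'.
  by move=> m'M; apply: size_cycles => t tm'; rewrite /cycle_length ifT //; lia.
rewrite take_cat sz // ltnNge leq_addr /= addKn; congr (_ ++ _).
  congr flatten; apply/eq_in_map => t; rewrite mem_iota add0n /= => tm'.
  by rewrite /cycle_length !ifT //; lia.
rewrite cycle_length_last takel_cat ?size_iota // take_iota.
by congr iota; apply/minn_idPl.
Qed.

Lemma xL_cells (F : fieldType) r m a (d : 'I_r) (tau : nat -> F)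
    (y : int -> 'I_r -> F) :
  (0 < m <= r)%N -> (a <= r - m.-1)%N -> tau_are_Y tau y ->
  xL r (word r m a) tau =
    \prod_(l <- cells d (cycle_length r m a) 0 m) xneg r l.2.+1 (y l.1%:Z l.2).
Proof.
move=> m_range a_le tauY; rewrite /xL size_word; last by lia.
set f := fun t => xneg r (letter (word r m a) t) (tau t).
pose L := cycle_length r m a.
have prodE n : (n < m)%N ->
    \prod_(1 <= t < (cycle_start r n + L n).+1) f t =
    \prod_(0 <= s < n.+1) \prod_(0 <= j < L s) f (cycle_start r s + j).+1.
  have row n' : \prod_((cycle_start r n').+1 <= t < (cycle_start r n' + L n').+1) f t =
                \prod_(0 <= j < L n') f (cycle_start r n' + j).+1.
    rewrite -[in LHS](add0n (cycle_start r n').+1) big_addn -addnS -addSnnS subDnCA // subnn addn0.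
    by apply: eq_bigr => j _; rewrite addnS addnC.
  elim: n => [|n IHn] nm.
    rewrite big_nat1 -row; congr (\prod_(_ <= t < _) f t).
    by rewrite /cycle_start big_geq.
  rewrite [RHS]big_nat_recr //= -IHn; last exact: ltnW.
  rewrite -row (@big_cat_nat _ _ _ (cycle_start r n.+1).+1) //=; last by rewrite !ltnS leq_addr.
  by congr (\prod_(_ <= t < _) f t * _); rewrite cycle_startS /L /cycle_length nm.
have := prodE m.-1; rewrite /L /cycle_length prednK; last by lia.
rewrite ltnn -/(cycle_length r m a) => ->; last by lia.
rewrite /cells big_flatten big_map /index_iota subn0.
rewrite [LHS]big_seq [RHS]big_seq; apply: eq_bigr => s; rewrite mem_iota add0n /= => sm.
rewrite big_map /index_iota subn0 -/(cycle_length r m a s).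
rewrite [LHS]big_seq [RHS]big_seq; apply: eq_bigr => j; rewrite mem_iota add0n /= => jL.
have jr : (j.+1 <= r - s)%N.
  by move: jL; rewrite /cycle_length; case: ifP; lia.
have jE : insubd d j = j :> nat by rewrite val_insubd; case: ifP; lia.
by rewrite /f letter_word // jE tauY jE // addnS.
Qed.

Lemma uniq_cells r (d : 'I_r) L s n :
  (forall t, (L t <= r)%N) -> uniq (cells d L s n).
Proof.
move=> Lr; apply: allpairs_uniq_dep; first exact: iota_uniq.
  by move=> t _; apply: iota_uniq.
move=> [t j] [t' j'] /allpairsPdep[t1 [j1 [_ + ->]]] /allpairsPdep[t2 [j2 [_ + ->]]] /=.
rewrite !mem_iota /= => jL jL' [tE /(congr1 val)]; subst.
have := Lr t2; rewrite /= !val_insubd => Lt.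
by rewrite !ifT; try lia; move=> ->.
Qed.

(** A cycle raises every number below its length by one, and [m' + D <= r.+1] keeps [x + n] below
    the length of each cycle met. *)
Lemma weyl_word_cycles r m' D n (x : 'I_r.+1) :
  (n <= m')%N -> (m' + D <= r.+1)%N -> (x < D)%N ->
  weyl_word r (cycles (cycle_length r m' D) (m' - n) n) x = (x + n)%N :> nat.
Proof.
move=> nm m'D xD; elim: n nm => [|n IHn] nm; first by rewrite /= perm1 addn0.
rewrite /cycles /= -/(cycles _ _ _) subnSK // weyl_word_cat.
have [Lr Lx] : (cycle_length r m' D (m' - n.+1) <= r /\
                x + n < cycle_length r m' D (m' - n.+1))%N.
  by rewrite /cycle_length; case: ifP; lia.
by rewrite weyl_word_iota ?add0n // IHn ?(ltnW nm) // ifF ?ifT ?addnS //; lia.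
Qed.

Lemma image_first_set r m' D :
  (m' + D <= r.+1)%N ->
  [set weyl_word r (cycles (cycle_length r m' D) 0 m') x | x in first_set r D] =
  steps r (profile D m' 0).
Proof.
move=> m'D; have wE (x : 'I_r.+1) : (x < D)%N ->
    weyl_word r (cycles (cycle_length r m' D) 0 m') x = (x + m')%N :> nat.
  by move=> xD; have := weyl_word_cycles (leqnn m') m'D xD; rewrite subnn.
apply/setP=> x; rewrite !inE; apply/imsetP/idP.
  case=> z; rewrite inE => zD ->; rewrite wE // /profile; lia.
rewrite /profile => xP; have zr : (x - m' < r.+1)%N by have := ltn_ord x; lia.
exists (Ordinal zr); rewrite ?inE /=; first by lia.
by apply: val_inj; rewrite /= wE /=; lia.
Qed.

(** Induction over the suffixes of the word: [k] counts the cycles after the current one, [n] the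
    letters left in it. Letters are handled by [demazure_step], passages between cycles by
    [frozen_next]. *)
Lemma demazure_cycles r (B : finType) (cB : crystal r B) v mu m m' d
    (Bw : 'S_r.+1 -> {set B}) :
  (0 < m' <= m)%N -> (m <= r)%N -> (m + d <= r)%N ->
  crystal_model cB v (Ylowest r m' m d.+1) mu -> is_demazure cB v Bw ->
  forall x, x \in Bw (weyl_word r (cycles (cycle_length r m' d.+1) 0 m')) <->
    exists2 g, height_fn m m' d.+1 g & mu x = path_monomial r m g.
Proof.
move=> m'm mr mdr cm dem.
pose L := cycle_length r m' d.+1.
suff dem_s k s p n : (s + k.+1 = m')%N -> (p + n = L s)%N -> forall x,
    x \in Bw (weyl_word r (iota p.+1 n ++ cycles L s.+1 k)) <->
    frozen_image mu m m' d.+1 s p.+1 x.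
  move=> x; have m'E : (0 + m'.-1.+1 = m')%N by lia.
  have := dem_s m'.-1 0%N 0%N (L 0%N) m'E (add0n _) x.
  rewrite [X in cycles _ 0 X](_ : m' = m'.-1.+1); last by lia.
  rewrite -/L => ->; split=> [[g [gP _ xg]]|[g gP xg]]; exists g => //; split=> //.
  by apply: (@frozen0 m) => //; lia.
elim: k s p n => [|k IHk] s p n sk pn; elim: n p pn => [|n IHn] p pn x.
- have sE : s = m'.-1 by lia.
  have pE : p = d.+1 by rewrite -(addn0 p) pn /L /cycle_length ifF //; lia.
  rewrite sE pE /= (dem_1 dem) inE; split=> [/eqP ->|[g [gP fr xg]]].
    exists (lowest_path d.+1 m'); split; first exact: height_fn_lowest.
      exact: (@frozen_of_lowest m).
    by rewrite (cm_low cm); apply/esym/path_monomial_lowest.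
  apply/eqP/(emb_inj (cm_emb cm)); rewrite (cm_low cm) xg.
  by apply: path_monomial_lowest => //; apply: frozen_lowest.
- have pr : (p < r)%N by move: pn; rewrite /L /cycle_length; case: ifP; lia.
  have nL : (p.+1 + n = L s)%N by lia.
  apply: (demazure_step cm (_ : (s < m)%N) (IHn p.+1 nL) (i := Ordinal pr)) => //; first by lia.
  move=> z; have := dem_rec dem
    (w := weyl_word r (iota p.+1 n.+1 ++ cycles L s.+1 0)) (i := Ordinal pr).
  rewrite [iota _ _]/= [_ ++ _]/= weyl_mul_word; apply.
  apply: (@reduced_word_step r (Ordinal pr)) => //=.
  by rewrite nL /L /cycle_length; case: ifP; lia.
- have -> : iota p.+1 0 ++ cycles L s.+1 k.+1 = iota 1 (L s.+1) ++ cycles L s.+2 k by [].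
  have sk' : (s.+1 + k.+1 = m')%N by lia.
  have := IHk s.+1 0%N (L s.+1) sk' (add0n _) x => ->.
  have pE : p = (r - s)%N by rewrite -(addn0 p) pn /L /cycle_length ifT //; lia.
  have fN g : height_fn m m' d.+1 g -> frozen d.+1 m' s p.+1 g <-> frozen d.+1 m' s.+1 1 g.
    by move=> gP; rewrite pE; apply: (@frozen_next m) => //; lia.
  by split=> -[g [gP fr xg]]; exists g; split=> //; apply/fN.
have pr : (p < r)%N by move: pn; rewrite /L /cycle_length; case: ifP; lia.
have nL : (p.+1 + n = L s)%N by lia.
apply: (demazure_step cm (_ : (s < m)%N) (IHn p.+1 nL) (i := Ordinal pr)) => //; first by lia.
move=> z; have := dem_rec dem
    (w := weyl_word r (iota p.+1 n.+1 ++ cycles L s.+1 k.+1)) (i := Ordinal pr).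
rewrite [iota _ _]/= [_ ++ _]/= weyl_mul_word; apply.
apply: (@reduced_word_step r (Ordinal pr)) => /=.
  by rewrite nL /L /cycle_length; case: ifP; lia.
apply/allP => j /flattenP[row /mapP[t]]; rewrite mem_iota => ts ->.
by rewrite mem_iota nL /L /cycle_length; case: ifP; case: ifP; lia.
Qed.

(** * Comparison of the minor with the Demazure crystal *)

Theorem theorem5p6 (R : realType) (r m a : nat)
    (r_ge1 : (1 <= r)%N) (m_range : (1 <= m <= r)%N)
    (a_range : (1 <= a <= r - m + 1)%N)
    (k : nat) (k_range : (1 <= k <= size (word r m a))%N)
    (d : 'I_r) (d_ik : letter (word r m a) k = d.+1) (d_in : a = d.+1)
    (m' : nat) (m'_range : (1 <= m' <= m)%N) (k_cycle : in_cycle r m' k)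
    (B : finType) (cB : crystal r B) (v : B)
    (B_lam : is_Bminus ((m'%:Z - m%:Z) *: fund_weight d) cB v)
    (mu : B -> monomial r) (mu_Y : is_mu cB v (Ylowest r m' m d.+1) mu)
    (Bw : 'S_r.+1 -> {set B}) (Bw_dem : is_demazure cB v Bw) :
  let u := u_le r (word r m a) k in
  (forall (tau : nat -> R[i]) (y : int -> 'I_r -> R[i]),
     (forall t, tau t != 0) -> (forall s i, y s i != 0) -> tau_are_Y tau y ->
     DeltaL r (word r m a) k tau =
       laurent_eval y (\sum_(x in Bw u) mono (mu x))) /\
  \sum_(x in Bw u) mono (mu x) = demazure_poly Bw mu u (fun=> 1).
Proof.
move=> u; split=> // tau y _ y0 tauY.
have mr : (m <= r)%N by lia.
have mdr : (m + d <= r)%N by lia.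
have m'm : (0 < m' <= m)%N by [].
have m'D : (m' + d.+1 <= r.+1)%N by lia.
have cm : crystal_model cB v (Ylowest r m' m d.+1) mu.
  split; [exact: mu_embedding mu_Y | exact: mu_lowest mu_Y |].
  by case: B_lam => V [E [F [T [T' [et [ft [v0 [L [g [_ _ _ cb _]]]]]]]]]]; apply: cb_ef cb.
have L_le t : (cycle_length r m a t <= r)%N by rewrite /cycle_length; case: ifP; lia.
have L_ge t : (t < m)%N -> (d.+1 + m - t.+1 <= cycle_length r m a t)%N.
  by rewrite /cycle_length; case: ifP; lia.
have kE : k = (cycle_start r m'.-1 + d.+1)%N.
  by rewrite -d_ik; apply: letter_position => //; lia.
(* The first [k] letters form a word of the same shape with [m'] cycles, the last of length [d.+1];
   the matrix product keeps all [m] cycles. *)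
have uE : u = weyl_word r (cycles (cycle_length r m' d.+1) 0 m').
  by rewrite /u /u_le kE take_word // /cycle_length; case: ifP; lia.
pose W := walks d.+1 (cells d (cycle_length r m a) 0 m) (profile d.+1 m' 0).
(* Both lists are free of repetitions, so it suffices that each consists of the monomials of the
   height functions. *)
have -> : \sum_(x in Bw u) mono (mu x) = \sum_(Z <- W) mono Z.
  rewrite -big_enum -(big_map mu xpredT (@mono r)); apply: perm_big; apply: uniq_perm.
  - by rewrite (map_inj_uniq (emb_inj (cm_emb cm))) enum_uniq.
  - by apply: walks_uniq; [exact: uniq_cells | exact: stairs_profile].
  have WE := @mem_walks_path r m m' d.+1 d _ _ m'D L_le L_ge.
  have BE := demazure_cycles m'm mr mdr cm Bw_dem.
  move=> Z; apply/mapP/idP => [[x]|/WE[g gP ZE]].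
    rewrite mem_enum uE => /BE[g gP xg] Zx.
    by apply/WE; exists g; rewrite // Zx.
  have [x xg] := path_monomial_in_image cm m'm mr m'D gP.
  by exists x; rewrite ?mem_enum ?uE ?xg //; apply/BE; exists g.
rewrite laurent_eval_sum -minor_walks //; last first.
- by rewrite -image_first_set // card_imset //; apply: perm_inj.
- exact: stairs_profile.
rewrite /DeltaL /Delta -/u uE d_ik image_first_set //.
by rewrite (@xL_cells _ _ _ _ d _ y) //; lia.
Qed.
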